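(* Let $G=1+\mathcal{A}=\bigcup_{m\in\mathbb{N}}G_{m}$ be an arbitrary AF-algebra group with $G_m=1+\mathcal{A}_m$, let $\Gamma=G\times G$ and $\Gamma_m=G_m\times G_m$, let $\mu\in\mathcal{M}^{+}_{\Gamma}(\mathcal{A}^{\circ})$ be an ergodic $\Gamma$-invariant measure on $\mathcal{A}^{\circ}$, and consider the corresponding indecomposable supercharacter $\xi^{\mu}$ of $G$, given by $\xi^{\mu}(g)=\int_{\mathcal{A}^{\circ}}\vartheta(g-1)\,d\mu(\vartheta)$ for $g\in G$. For every $\vartheta\in\mathcal{A}^{\circ}$, let $\vartheta_{m}\in(\mathcal{A}_{m})^{\circ}$ denote the restriction of $\vartheta$ to $\mathcal{A}_{m}$, and let $\xi_{m}$ be the indecomposable supercharacter of the finite group $G_{m}$ which corresponds to the $\Gamma_{m}$-orbit $\Gamma_{m}\cdot\vartheta_{m}$. Then, for $\mu$-almost every $\vartheta\in\mathcal{A}^{\circ}$, we have $$\xi^{\mu}(g)=\lim_{m\to\infty}\xi_{m}(g),\qquad g\in G.$$ Furthermore, every indecomposable supercharacter of $G$ is of this form.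
   Context: An associative algebra is nil if every element is nilpotent. For a nil $\Bbbk$-algebra $\mathcal{A}$, the algebra group $G=1+\mathcal{A}$ is the set of formal objects $1+a$ with multiplication $(1+a)(1+b)=1+a+b+ab$. $G$ is an AF-algebra group (approximately finite) if there are a chain $\Bbbk_1\subseteq\Bbbk_2\subseteq\cdots$ of subfields of $\Bbbk$ and a chain $G_1\subseteq G_2\subseteq\cdots$ of finite subgroups of $G$ such that each $G_m=1+\mathcal{A}_m$ for some $\Bbbk_m$-subalgebra $\mathcal{A}_m$ of $\mathcal{A}$, and $G=\bigcup_{m}G_m$. $G$ carries the discrete topology (it is countable). $\mathcal{A}^{\circ}$ is the Pontryagin dual of the additive group of $\mathcal{A}$, with the topology of pointwise convergence; $\Gamma=G\times G$ acts on $\mathcal{A}^{\circ}$ by $((g,h)\cdot\vartheta)(a)=\vartheta(g^{-1}ah)$, and similarly $\Gamma_m$ acts on $(\mathcal{A}_m)^{\circ}$. $\mathcal{M}^{+}_{\Gamma}(\mathcal{A}^{\circ})$ is the set of $\Gamma$-invariant regular Borel probability measures; $\mu$ is ergodic if $\mu(B)\in\{0,1\}$ for every $\Gamma$-invariant Borel set $B$. A superclass of $G$ is a set $1+GaG$, $a\in\mathcal{A}$. A supercharacter of $G$ is a positive definite function $\varphi\colon G\to\mathbb{C}$ with $\varphi(1)=1$ that is constant on superclasses; the indecomposable supercharacters are the extreme points of the convex set of supercharacters. The assignment $\mu\mapsto\xi^\mu$ is a bijection from ergodic measures in $\mathcal{M}^{+}_{\Gamma}(\mathcal{A}^{\circ})$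 onto indecomposable supercharacters of $G$. For the finite group $G_m$, the indecomposable supercharacter corresponding to a $\Gamma_m$-orbit $\mathcal{O}\subseteq(\mathcal{A}_m)^{\circ}$ is $\xi^{\mathcal{O}}(g)=\frac{1}{|\mathcal{O}|}\sum_{\theta\in\mathcal{O}}\theta(g-1)$, $g\in G_m$. For $g\in G$, $\xi_m(g)$ is defined for all sufficiently large $m$ (those with $g\in G_m$). *)

(* Defs.v *)
From HB Require Import structures.
From mathcomp Require Import all_boot all_order all_algebra finmap complex.
From mathcomp Require Import all_classical all_reals all_analysis.

Set Implicit Arguments.
Unset Strict Implicit.
Unset Printing Implicit Defensive.

Import Order.TTheory GRing.Theory Num.Theory.
Import numFieldNormedType.Exports.

Local Open Scope classical_set_scope.
Local Open Scope ring_scope.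
Local Open Scope complex_scope.

Reserved Notation "a ** b" (at level 40, left associativity).

(* Nil algebras have no unit, so the ring structures of ssralg do not apply.
   The multiplication is put on [nilRng] (a nil ring, i.e. a nil algebra
   without the scalars) because the algebra group and its action on the dual
   only depend on it; scalars are added in [nilAlgType]. *)

(* [iter n (nmul a) a] is the power a ^ (n + 1). *)
HB.mixin Record Zmodule_isNilRng A of GRing.Zmodule A := {
  nmul : A -> A -> A;
  nmulA : associative nmul;
  nmulDl : left_distributive nmul +%R;
  nmulDr : right_distributive nmul +%R;
  nmul_nil : forall a, exists n, iter n (nmul a) a = 0
}.

#[short(type="nilRng")]
HB.structure Definition NilRng := {A of GRing.Zmodule A & Zmodule_isNilRng A}.

Notation "a ** b" := (nmul a b) : ring_scope.

HB.mixin Record Lmodule_isNilAlgebra (k : fieldType) A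
    of GRing.Lmodule k A & NilRng A := {
  nscaleAl : forall (c : k) (a b : A), c *: (a ** b) = (c *: a) ** b;
  nscaleAr : forall (c : k) (a b : A), c *: (a ** b) = a ** (c *: b)
}.

#[short(type="nilAlgType")]
HB.structure Definition NilAlgebra (k : fieldType) :=
  {A of GRing.Lmodule k A & NilRng A & Lmodule_isNilAlgebra k A}.

Section NilRngTheory.
Variable A : nilRng.
Implicit Types a b c : A.

Lemma nmul0r a : 0 ** a = 0.
Proof. by apply: (addrI (0 ** a)); rewrite -nmulDl !addr0. Qed.

Lemma nmulr0 a : a ** 0 = 0.
Proof. by apply: (addrI (a ** 0)); rewrite -nmulDr !addr0. Qed.

Lemma nmulrN a b : a ** (- b) = - (a ** b).
Proof. by apply: (addrI (a ** b)); rewrite -nmulDr !subrr nmulr0. Qed.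

Lemma nmulNr a b : (- a) ** b = - (a ** b).
Proof. by apply: (addrI (a ** b)); rewrite -nmulDl !subrr nmul0r. Qed.

Lemma nil_index_subproof a : exists n, iter n (nmul a) a == 0.
Proof. by have [n an0] := nmul_nil a; exists n; apply/eqP. Qed.

Definition nil_index a := ex_minn (nil_index_subproof a).

(* The finite alternating sum - a + a ^ 2 - a ^ 3 + ... *)
Definition quasi_inv a :=
  iter (nil_index a) (fun b => - (a + a ** b)) 0.

Lemma quasi_invr a : a + quasi_inv a + a ** quasi_inv a = 0.
Proof.
rewrite /quasi_inv /nil_index; case: ex_minnP => n /eqP an0 _.
set f := fun b => - (a + a ** b).
have diff m : iter m.+1 f 0 - iter m f 0 = iter m (nmul a) a \/
    iter m.+1 f 0 - iter m f 0 = - iter m (nmul a) a.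
  elim: m => [|m IHm]; first by right; rewrite /= /f nmulr0 addr0 subr0.
  have -> : iter m.+2 f 0 - iter m.+1 f 0 =
      - (a ** (iter m.+1 f 0 - iter m f 0)).
    rewrite [iter m.+2 _ _]iterS [in X in _ - X]iterS /f nmulDr nmulrN.
    by rewrite -/f opprD opprK addrACA addNr add0r opprB addrC.
  by case: IHm => ->; [right | left]; rewrite ?nmulrN ?opprK iterS.
have fixn : iter n.+1 f 0 = iter n f 0.
  by apply/eqP; rewrite -subr_eq0; case: (diff n) => ->; rewrite an0 ?oppr0.
by rewrite -{1}fixn iterS /f opprD addrA subrr add0r addNr.
Qed.

Lemma quasi_inv_comm a : a ** quasi_inv a = quasi_inv a ** a.
Proof.
rewrite /quasi_inv; elim: (nil_index a) => [|n IHn].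
  by rewrite nmulr0 nmul0r.
by rewrite iterS nmulrN nmulNr nmulDr nmulDl -nmulA -IHn.
Qed.

Lemma quasi_invl a : quasi_inv a + a + quasi_inv a ** a = 0.
Proof. by rewrite -quasi_inv_comm [quasi_inv a + a]addrC quasi_invr. Qed.

End NilRngTheory.

(* [OnePlus a] is the formal object 1 + a, and [sub1 g] is g - 1. *)
Record alg_group (A : nilRng) := OnePlus { sub1 : A }.

Section AlgGroup.
Variable A : nilRng.
Implicit Types g h : alg_group A.

HB.instance Definition _ := [isNew for @sub1 A].
HB.instance Definition _ := [Choice of alg_group A by <:].

Definition agmul g h := OnePlus (sub1 g + sub1 h + sub1 g ** sub1 h).
Definition agone : alg_group A := OnePlus 0.
Definition aginv g := OnePlus (quasi_inv (sub1 g)).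

Lemma agmulA : associative agmul.
Proof.
move=> [x] [y] [z]; congr OnePlus => /=.
rewrite !nmulDr !nmulDl nmulA !addrA.
by rewrite [LHS](ACl (1*2*5*3*6*4*7)).
Qed.

Lemma agmul1g : left_id agone agmul.
Proof. by case=> x; congr OnePlus => /=; rewrite nmul0r add0r addr0. Qed.

Lemma agmulg1 : right_id agone agmul.
Proof. by case=> x; congr OnePlus => /=; rewrite nmulr0 !addr0. Qed.

Lemma agmulVg : left_inverse agone aginv agmul.
Proof. by case=> x; congr OnePlus => /=; exact: quasi_invl. Qed.

Lemma agmulgV : right_inverse agone aginv agmul.
Proof. by case=> x; congr OnePlus => /=; exact: quasi_invr. Qed.

HB.instance Definition _ := isGroup.Build (alg_group A)
  agmulA agmul1g agmulg1 agmulVg agmulgV.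

(* The element g a h of A, for g = 1 + x and h = 1 + y. *)
Definition bimul (gam : alg_group A * alg_group A) (a : A) : A :=
  let ga := a + sub1 gam.1 ** a in ga + ga ** sub1 gam.2.

Lemma bimul_is_zmod_morphism gam : zmod_morphism (bimul gam).
Proof.
move=> a b; rewrite /bimul nmulDr nmulrN.
have subACA (x y z t : A) : x - y + (z - t) = (x + z) - (y + t).
  by rewrite opprD addrACA.
by rewrite subACA nmulDl nmulNr subACA.
Qed.

HB.instance Definition _ gam :=
  GRing.isZmodMorphism.Build A A (bimul gam) (bimul_is_zmod_morphism gam).

(* 1 + G a G *)
Definition superclass (a : A) : set (alg_group A) :=
  [set OnePlus (bimul gam a) | gam in [set: alg_group A * alg_group A]].

End AlgGroup.

Section Supercharacters.
Variables (R : realType) (A : nilRng).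
Local Notation G := (alg_group A).
Implicit Types phi : G -> R[i].

(* In R[i], [0 <= z] means that z is real and nonnegative. *)
Definition positive_definite phi := forall n (g : 'I_n -> G) (c : 'I_n -> R[i]),
  0 <= \sum_(i < n) \sum_(j < n) c i * (c j)^* * phi ((g j)^-1 * g i)%g.

Definition supercharacter phi :=
  [/\ positive_definite phi, phi 1%g = 1 &
      forall a g h, superclass a g -> superclass a h -> phi g = phi h].

Definition indecomposable_supercharacter phi :=
  supercharacter phi /\
  forall (phi1 phi2 : G -> R[i]) (t : R),
    supercharacter phi1 -> supercharacter phi2 -> 0 < t < 1 ->
    (forall g, phi g = t%:C * phi1 g + (1 - t)%:C * phi2 g) ->
    phi1 = phi /\ phi2 = phi.

End Supercharacters.

Section PontryaginDual.
Variable R : realType.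

Definition unitary_character (V : zmodType) : set {ptws V -> R[i]^o} :=
  [set chi | (forall a, `|chi a| = 1 :> R[i]) /\
             (forall a b, chi (a + b) = chi a * chi b :> R[i])].

(* The Pontryagin dual of the discrete group V; as a [set_type] it carries the
   subspace topology of the topology of pointwise convergence. *)
Definition pdual (V : zmodType) := set_type (@unitary_character V).

HB.instance Definition _ V := Topological.on (pdual V).

Definition pdual_eval (V : zmodType) (theta : pdual V) (a : V) : R[i] :=
  set_val theta a.

Lemma pdual_comp_subproof (U V : zmodType) (f : {additive U -> V})
  (theta : pdual V) : (pdual_eval theta \o f) \in @unitary_character U.
Proof.
have [nor1 mor] := set_mem (valP theta).
apply/mem_set; split=> [a | a b]; first exact: nor1.
by rewrite /= raddfD; exact: mor.
Qed.

Definition pdual_comp (U V : zmodType) (f : {additive U -> V})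
    (theta : pdual V) : pdual U :=
  exist (fun chi => chi \in @unitary_character U) _ (pdual_comp_subproof f theta).

Lemma pdual1_subproof (V : zmodType) :
  (fun=> 1 : R[i]) \in @unitary_character V.
Proof.
by apply/mem_set; split=> [a | a b]; rewrite ?normr1 ?mulr1.
Qed.

HB.instance Definition _ V :=
  isPointed.Build (pdual V)
    (exist (fun chi => chi \in @unitary_character V) _ (pdual1_subproof V)).

End PontryaginDual.

Section DualAction.
Variables (R : realType) (A : nilRng).
Local Notation G := (alg_group A).

Definition dual_act (gam : G * G) (theta : pdual R A) : pdual R A :=
  pdual_comp (bimul (gam.1^-1, gam.2)%g) theta.

Definition dual_orbit (theta : pdual R A) : set (pdual R A) :=
  [set dual_act gam theta | gam in [set: G * G]].

(* Only meaningful when the orbit is finite: for an infinite set, [fset_set]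
   is empty. *)
Definition orbit_supercharacter (O : set (pdual R A)) (g : G) : R[i] :=
  (#|` fset_set O|%:R)^-1 * \sum_(theta \in O) pdual_eval theta (sub1 g).

End DualAction.

Definition borel (T : ptopologicalType) := g_sigma_algebraType (@open T).

Definition regular_measure (R : realType) (T : ptopologicalType)
    (mu : set (borel T) -> \bar R) :=
  forall B : set (borel T), measurable B ->
    mu B = ereal_inf [set mu U | U in [set U : set T | open U /\ B `<=` U]] /\
    mu B = ereal_sup [set mu K | K in [set K : set T | compact K /\ K `<=` B]].

Section InvariantMeasures.
Variables (R : realType) (A : nilRng).
Local Notation G := (alg_group A).
Local Notation dualA := (borel (pdual R A)).
Implicit Types mu : probability dualA R.

Definition invariant_measure mu :=
  regular_measure mu /\
  forall (gam : G * G) (B : set dualA),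
    measurable B -> mu (dual_act gam @` B) = mu B.

Definition ergodic_measure mu :=
  forall B : set dualA, measurable B ->
    (forall gam : G * G, dual_act gam @` B = B) -> mu B = 0%E \/ mu B = 1%E.

Definition xi_measure mu (g : G) : R[i] :=
  (\int[mu]_theta complex.Re (pdual_eval (theta : pdual R A) (sub1 g))) +i*
  (\int[mu]_theta complex.Im (pdual_eval (theta : pdual R A) (sub1 g))).

End InvariantMeasures.

Record subalgebra (k : fieldType) (A : nilAlgType k) (K : {pred k}) :=
  Subalgebra {
    subalg_pred :> {pred A};
    subalg_zmod : zmod_closed subalg_pred;
    subalg_scale : {in K & subalg_pred, forall c a, c *: a \in subalg_pred};
    subalg_mul : {in subalg_pred &, forall a b, a ** b \in subalg_pred}
  }.

Section SubalgebraType.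
Variables (k : fieldType) (A : nilAlgType k) (K : {pred k}).
Variable S : subalgebra A K.

Definition subalg_sort := {a : A | a \in subalg_pred S}.
HB.instance Definition _ := SubChoice.on subalg_sort.
HB.instance Definition _ := GRing.SubChoice_isSubZmodule.Build A _ subalg_sort
  (subalg_zmod S).

Definition subalg_nmul (a b : subalg_sort) : subalg_sort :=
  Sub (val a ** val b) (subalg_mul (valP a) (valP b)).

Lemma subalg_nmulA : associative subalg_nmul.
Proof. by move=> a b c; apply/val_inj; rewrite !SubK nmulA. Qed.

Lemma subalg_nmulDl : left_distributive subalg_nmul +%R.
Proof.
by move=> a b c; apply/val_inj; rewrite [RHS]raddfD !SubK -nmulDl.
Qed.

Lemma subalg_nmulDr : right_distributive subalg_nmul +%R.
Proof.
by move=> a b c; apply/val_inj; rewrite [RHS]raddfD !SubK -nmulDr.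
Qed.

Lemma subalg_nmul_nil (a : subalg_sort) : exists n, iter n (subalg_nmul a) a = 0.
Proof.
have [n an0] := nmul_nil (val a); exists n; apply/val_inj; rewrite raddf0 -an0.
by elim: n {an0} => // n IHn; rewrite !iterS -IHn SubK.
Qed.

HB.instance Definition _ := Zmodule_isNilRng.Build subalg_sort
  subalg_nmulA subalg_nmulDl subalg_nmulDr subalg_nmul_nil.

(* The subset 1 + S of 1 + A. *)
Definition one_plus : set (alg_group A) :=
  [set g | sub1 g \in subalg_pred S].

Lemma one_plus_group_closed : group_closed [in one_plus].
Proof.
have [S0 SB] := subalg_zmod S.
have SN a : a \in subalg_pred S -> - a \in subalg_pred S.
  by move=> Sa; rewrite -sub0r SB.
have SD a b : a \in subalg_pred S -> b \in subalg_pred S ->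
    a + b \in subalg_pred S.
  by move=> Sa Sb; rewrite -[b]opprK SB ?SN.
have SV a : a \in subalg_pred S -> quasi_inv a \in subalg_pred S.
  move=> Sa; rewrite /quasi_inv; elim: (nil_index a) => //= n IHn.
  by rewrite SN // SD // subalg_mul.
split; first by rewrite inE /one_plus /= S0.
move=> g h; rewrite !inE /one_plus /= => Sg Sh.
by rewrite !SD ?subalg_mul ?SV.
Qed.

(* The supercharacter of 1 + S attached to the orbit of the restriction to S of
   the character [theta] of A, extended by 0 to 1 + A. *)
Definition restr_supercharacter (R : realType) (theta : pdual R A)
    (g : alg_group A) : R[i] :=
  if insub (sub1 g) is Some a then
    orbit_supercharacter
      (dual_orbit (pdual_comp (val : subalg_sort -> A) theta))
      (OnePlus (a : subalg_sort))
  else 0.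

End SubalgebraType.

(* The groups G_m of the chain are the sets [one_plus (af_alg m)]; they are
   subgroups of 1 + A by [one_plus_group_closed]. *)
Record AF_structure (k : fieldType) (A : nilAlgType k) := {
  af_field : nat -> divringClosed k;
  af_alg : forall m, subalgebra A (af_field m);
  af_field_chain : forall m, {subset af_field m <= af_field m.+1};
  af_group_chain : forall m, one_plus (af_alg m) `<=` one_plus (af_alg m.+1);
  af_group_finite : forall m, finite_set (one_plus (af_alg m));
  af_group_cover : \bigcup_m one_plus (af_alg m) = setT
}.

(* Main.v *)
From HB Require Import structures.
Require Import Defs.
From mathcomp Require Import all_boot all_order all_algebra complex finmap.
From mathcomp Require Import all_classical all_reals all_analysis.
From mathcomp Require Import measurable_realfun lra.

(** Let [Gam_n = G_n * G_n].  The value at [1 + a] of the supercharacter of [G_n]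
    attached to [theta] is the average over [Gam_n] of the function
    [chi |-> chi a] along the orbit of [theta], so the convergence is a pointwise
    ergodic theorem for the locally finite group [G * G].  It is proved by a
    maximal inequality: if the averages of [f] exceed [c] infinitely often on
    a set of positive measure, that set is invariant, hence of full measure, and
    then [\int f >= c].

    Conversely, let [xi] be a supercharacter.  Since [h^-1 g - 1 = h^-1 (g - h)]
    lies in [G (g - h) G], the function [a |-> xi (1 + a)] is positive definite on
    the additive group of [A], so Bochner's theorem represents it by
    a probability on the dual, invariant because Fourier transforms are
    injective on probabilities; it is ergodic if [xi] is indecomposable, since
    conditioning on an invariant set and on its complement would decompose
    [xi].  For Bochner's theorem, [A] is a countable union of finite groups of
    prime exponent, so Fourier inversion on these gives a consistent family
    of masses on the clopen sets of the compact dual. *)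

Set Implicit Arguments.
Unset Strict Implicit.
Unset Printing Implicit Defensive.

Import Order.TTheory GRing.Theory Num.Theory.
Import numFieldNormedType.Exports.
Local Open Scope classical_set_scope.
Local Open Scope ring_scope.
Local Open Scope complex_scope.

(** * Expectations of bounded real random variables *)

Section BoundedRandomVariables.
Context d (T : measurableType d) (R : realType) (P : probability T R).
Implicit Types f g : T -> R.

Definition bounded_mfun f :=
  measurable_fun setT f /\ exists K, forall x, `|f x| <= K.

Lemma bounded_mfun_cst c : bounded_mfun (fun=> c).
Proof. by split=> //; exists `|c|. Qed.

Lemma bounded_mfunD f g :
  bounded_mfun f -> bounded_mfun g -> bounded_mfun (fun x => f x + g x).
Proof.
move=> [mf [K Kf]] [mg [L Lg]]; split; first exact: measurable_funD.
by exists (K + L) => x; rewrite (le_trans (ler_normD _ _)) ?lerD.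
Qed.

Lemma bounded_mfunM f g :
  bounded_mfun f -> bounded_mfun g -> bounded_mfun (fun x => f x * g x).
Proof.
move=> [mf [K Kf]] [mg [L Lg]]; split; first exact: measurable_funM.
by exists (K * L) => x; rewrite normrM ler_pM.
Qed.

Lemma bounded_mfunN f : bounded_mfun f -> bounded_mfun (fun x => - f x).
Proof.
move=> [mf [K Kf]]; split; first exact: measurableT_comp.
by exists K => x; rewrite normrN.
Qed.

Lemma bounded_mfun_indic (B : set T) : measurable B -> bounded_mfun \1_B.
Proof.
move=> mB; split; first exact: measurable_indic.
by exists 1 => x; rewrite indicE; case: (_ \in _); rewrite ?normr1 ?normr0.
Qed.

Lemma bounded_mfun_sum (I : Type) (s : seq I) (F : I -> T -> R) :
  (forall i, bounded_mfun (F i)) -> bounded_mfun (fun x => \sum_(i <- s) F i x).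
Proof.
move=> bF; elim: s => [|i s IHs].
  by under eq_fun do rewrite big_nil; exact: bounded_mfun_cst.
by under eq_fun do rewrite big_cons; exact: bounded_mfunD.
Qed.

(** Averages over finite sets of transformations are sums of this shape. *)
Lemma bounded_mfun_fsum (I : choiceType) (D : set I) (F : I -> T -> R) :
    finite_set D -> (forall i, bounded_mfun (F i)) ->
  bounded_mfun (fun x => \sum_(i \in D) F i x).
Proof.
move=> finD bF; under eq_fun do rewrite fsbig_finite//.
exact: bounded_mfun_sum.
Qed.

Lemma bounded_mfun_comp (phi : T -> T) f :
  measurable_fun setT phi -> bounded_mfun f -> bounded_mfun (f \o phi).
Proof.
move=> mphi [mf [K Kf]]; split; first exact: measurableT_comp.
by exists K => x; exact: Kf.
Qed.

Lemma bounded_mfun_integrable f : bounded_mfun f -> P.-integrable setT (EFin \o f).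
Proof.
move=> [mf [K Kf]]; apply: measurable_bounded_integrable => //.
  by rewrite -ge0_fin_numE// fin_num_measure.

exists K; split; first exact: num_real.
by move=> M KM x _; exact: le_trans (Kf x) (ltW KM).
Qed.
#[local] Hint Resolve bounded_mfun_integrable : core.

Lemma mean_add f g : bounded_mfun f -> bounded_mfun g ->
  \int[P]_x (f x + g x) = \int[P]_x f x + \int[P]_x g x.
Proof. by move=> bf bg; rewrite RintegralD; auto. Qed.

Lemma mean_scale c f : bounded_mfun f ->
  \int[P]_x (c * f x) = c * \int[P]_x f x.
Proof. by move=> bf; rewrite RintegralZl; auto. Qed.

Lemma mean_opp f : bounded_mfun f -> \int[P]_x (- f x) = - \int[P]_x f x.
Proof.
move=> bf; rewrite -mulN1r -mean_scale//.
by apply: eq_Rintegral => x _; rewrite mulN1r.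
Qed.

Lemma mean_le f g : bounded_mfun f -> bounded_mfun g ->
  (forall x, f x <= g x) -> \int[P]_x f x <= \int[P]_x g x.
Proof. by move=> bf bg fg; apply: le_Rintegral; auto. Qed.

Lemma mean_cst c : \int[P]_x c = c.
Proof.
by rewrite Rintegral_cst// [X in fine X](probability_setT P : _ = 1%E) mulr1.
Qed.

Lemma mean_indic (B : set T) : measurable B -> \int[P]_x (\1_B x) = fine (P B).
Proof. by move=> mB; rewrite /Rintegral integral_indic// setIT. Qed.

Lemma mean_sum (I : Type) (s : seq I) (F : I -> T -> R) :
    (forall i, bounded_mfun (F i)) ->
  \int[P]_x (\sum_(i <- s) F i x) = \sum_(i <- s) \int[P]_x F i x.
Proof.
move=> bF; elim: s => [|i s IHs].
  by rewrite big_nil; under eq_Rintegral do rewrite big_nil; rewrite mean_cst.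
under eq_Rintegral do rewrite big_cons.
by rewrite mean_add ?big_cons ?IHs//; exact: bounded_mfun_sum.
Qed.

Lemma mean_fsum (I : choiceType) (D : set I) (F : I -> T -> R) :
    finite_set D -> (forall i, bounded_mfun (F i)) ->
  \int[P]_x (\sum_(i \in D) F i x) = \sum_(i \in D) \int[P]_x F i x.
Proof.
move=> finD bF; under eq_Rintegral do rewrite fsbig_finite//.
by rewrite mean_sum// fsbig_finite.
Qed.

Lemma mean_comp (Q : probability T R) (phi : T -> T) f :
    measurable_fun setT phi ->
    (forall B, measurable B -> P (phi @^-1` B) = Q B) -> bounded_mfun f ->
  \int[P]_x f (phi x) = \int[Q]_x f x.
Proof.
move=> mphi PQ bf; rewrite /Rintegral; congr fine.
have bfphi := bounded_mfun_comp mphi bf.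
transitivity (\int[pushforward P phi]_x (f x)%:E)%E; last first.
  by apply: eq_measure_integral => B mB _; exact: PQ.
rewrite (integral_pushforward mphi)//.
  by apply/measurable_EFinP; case: bf.
by rewrite preimage_setT; exact: (bounded_mfun_integrable bfphi).
Qed.

End BoundedRandomVariables.

(** * A pointwise ergodic theorem for averages over an increasing chain of finite sets *)

Section ErgodicAverages.
Context d (T : measurableType d) (R : realType) (P : probability T R).
Variables (I : choiceType) (act : I -> T -> T) (mul : I -> I -> I).
(** The sets [D n] play the role of the finite groups [Gam_n]; [D_mul] expresses that right
    translations by elements of [D n] permute [D n]. *)
Variable D : nat -> set I.
Hypothesis D_finite : forall n, finite_set (D n).
Hypothesis D_neq0 : forall n, D n !=set0.
Hypothesis D_chain : forall m n, (m <= n)%N -> D m `<=` D n.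
Hypothesis act_mul : forall i j x, act i (act j x) = act (mul i j) x.
Hypothesis D_mul : forall n j, D n j -> set_bij (D n) (D n) (mul^~ j).
Hypothesis act_measurable : forall i, measurable_fun setT (act i).
Hypothesis act_invariant : forall i B, measurable B -> P (act i @^-1` B) = P B.
Hypothesis act_ergodic : forall B, measurable B ->
  (forall n i, D n i -> act i @^-1` B = B) -> P B = 0%E \/ P B = 1%E.
Implicit Types f g : T -> R.

Definition average n f x :=
  (#|` fset_set (D n)|%:R)^-1 * \sum_(i \in D n) f (act i x).

Lemma card_D_gt0 n : 0 < (#|` fset_set (D n)|%:R : R).
Proof.
rewrite ltr0n lt0n cardfs_eq0; apply/eqP => D0; have [i Di] := D_neq0 n.
by move: (mem_set Di); rewrite -in_fset_set// D0.
Qed.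

Lemma bounded_average n f : bounded_mfun f -> bounded_mfun (average n f).
Proof.
move=> bf; apply: bounded_mfunM; first exact: bounded_mfun_cst.
by apply: bounded_mfun_fsum => // i; exact: bounded_mfun_comp.
Qed.

Lemma average_act n f i x : D n i -> average n f (act i x) = average n f x.
Proof.
move=> Di; congr (_ * _); rewrite [RHS](reindex_fsbig _ _ _ _ (D_mul Di)).
by apply: eq_fsbigr => j _; rewrite act_mul.
Qed.

Lemma averageN n f x : average n (fun y => - f y) x = - average n f x.
Proof.
rewrite /average !fsbig_finite// -mulrN; congr (_ * _).
by rewrite sumrN.
Qed.

Lemma average_cst n c x : average n (fun=> c) x = c.
Proof.
rewrite /average fsbig_finite// big_const_seq count_predT iter_addr_0.
by rewrite -[X in _ * X]mulr_natl mulrA mulVf ?mul1r// gt_eqF ?card_D_gt0.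
Qed.

(** Since [E] is invariant, its indicator can be moved inside the average, which becomes the average
    of [f * \1_E]; each term of the latter has the same mean because the maps preserve [P]. *)
Lemma mean_average_indic n f (E : set T) : bounded_mfun f -> measurable E ->
    (forall i, D n i -> act i @^-1` E = E) ->
  \int[P]_x (average n f x * \1_E x) = \int[P]_x (f x * \1_E x).
Proof.
move=> bf mE invE; pose h x := f x * \1_E x.
have bh : bounded_mfun h by apply: bounded_mfunM => //; exact: bounded_mfun_indic.
transitivity (\int[P]_x average n h x).
  apply: eq_Rintegral => x _; rewrite /average -mulrA; congr (_ * _).
  rewrite !fsbig_finite// mulr_suml !big_seq; apply: eq_bigr => i.
  rewrite in_fset_set// => /set_mem Di; rewrite /h; congr (_ * _).
  rewrite !indicE; congr (_%:R); apply/f_equal; apply/idP/idP; rewrite !inE.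
    by rewrite -{1}(invE _ Di).
  by rewrite -{2}(invE _ Di).
have bhi i : bounded_mfun (fun x => h (act i x)) by exact: bounded_mfun_comp.
rewrite /average mean_scale; last by apply: bounded_mfun_fsum.
rewrite mean_fsum//.
rewrite (eq_fsbigr (fun=> \int[P]_x h x)); last first.
  by move=> i _; apply: (mean_comp (f := h)) => // B; exact: act_invariant.
rewrite fsbig_finite// big_const_seq count_predT iter_addr_0.
by rewrite -[X in _ * X]mulr_natl mulrA mulVf ?mul1r// gt_eqF ?card_D_gt0.
Qed.

(** The upper end [n] makes the window finite, so that an induction on its length starts from the
    empty set; the lower end [m] makes the set invariant under [D m]. *)
Definition exceed f c m n : set T :=
  [set x | exists j, (m <= j <= n)%N /\ c < average j f x].

Lemma measurable_average_gt n f c : bounded_mfun f ->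
  measurable [set x | c < average n f x].
Proof.
move=> bf; have [mA _] := bounded_average n bf.
rewrite -[X in measurable X]setTI.
rewrite (_ : [set x | c < average n f x] = average n f @^-1` `]c, +oo[%classic).
  exact: mA.
by apply/seteqP; split=> x /=; rewrite in_itv/= andbT.
Qed.

Lemma exceed_recl f c m n : (m <= n)%N ->
  exceed f c m n = [set x | c < average m f x] `|` exceed f c m.+1 n.
Proof.
move=> mn; apply/seteqP; split=> x /=.
  move=> [j [/andP[mj jn] cj]]; move: mj; rewrite leq_eqVlt => /predU1P[mj|mj].
    by left; rewrite mj.
  by right; exists j; rewrite mj.
move=> [cm|[j [/andP[mj jn] cj]]]; first by exists m; rewrite leqnn.
by exists j; rewrite (ltnW mj).
Qed.

Lemma exceed_empty f c m n : (n < m)%N -> exceed f c m n = set0.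
Proof.
move=> nm; apply/seteqP; split=> x //= [j [/andP[mj jn] _]].
by have := leq_ltn_trans (leq_trans mj jn) nm; rewrite ltnn.
Qed.

Lemma measurable_exceed f c m n : bounded_mfun f -> measurable (exceed f c m n).
Proof.
move=> bf; move k : (n.+1 - m)%N => k'; elim: k' m k => [|k' IHk] m mk.
  rewrite exceed_empty; first exact: measurable0.
  by rewrite -subn_eq0 mk.
have mn : (m <= n)%N by rewrite -ltnS -subn_gt0 mk.
rewrite exceed_recl//; apply: measurableU; first exact: measurable_average_gt.
by apply: IHk; rewrite subnS mk.
Qed.

Lemma exceed_act f c m n i x : D m i ->
  exceed f c m n (act i x) <-> exceed f c m n x.
Proof.
move=> Di; split=> -[j [/andP[mj jn] cj]]; exists j; rewrite mj jn; split=> //.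
  by rewrite -(average_act f x (D_chain mj Di)).
by rewrite (average_act f x (D_chain mj Di)).
Qed.

(* Downward induction on [m]: the points where index [m] is the last one to
   exceed [c] form a [D m]-invariant set, on which [f] and [average m f] have
   the same integral. *)
Lemma maximal_inequality f c m n : bounded_mfun f ->
  0 <= \int[P]_x ((f x - c) * \1_(exceed f c m n) x).
Proof.
move=> bf; move k : (n.+1 - m)%N => k'.
have bc : bounded_mfun (fun x => f x - c).
  by apply: bounded_mfunD => //; exact: bounded_mfun_cst.
elim: k' m k => [|k' IHk] m mk.
  rewrite exceed_empty; last by rewrite -subn_eq0 mk.
  by under eq_Rintegral do rewrite indic0 mulr0; rewrite mean_cst.
have mn : (m <= n)%N by rewrite -ltnS -subn_gt0 mk.
pose M := exceed f c m.+1 n; pose E := [set x | c < average m f x] `\` M.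
have mM : measurable M by exact: measurable_exceed.
have mE : measurable E.
  by apply: measurableD => //; exact: measurable_average_gt.
have -> : \int[P]_x ((f x - c) * \1_(exceed f c m n) x) =
    \int[P]_x ((f x - c) * \1_E x + (f x - c) * \1_M x).
  apply: eq_Rintegral => x _; rewrite -mulrDr; congr (_ * _).
  rewrite exceed_recl// -/M !indicE /E in_setU in_setD.
  by case: (x \in M); case: (x \in _); rewrite /= ?addr0 ?add0r.
rewrite mean_add; [|by apply: bounded_mfunM => //; exact: bounded_mfun_indic..].
rewrite addr_ge0//; last by apply: IHk; rewrite subnS mk.
have invE i : D m i -> act i @^-1` E = E.
  move=> Di; apply/seteqP; split=> x /= [cx Mx]; split.
  - by rewrite /= -(average_act f x Di).
  - by move=> /(exceed_act f c n x (D_chain (leqnSn m) Di)).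
  - by rewrite /= (average_act f x Di).
  - by move=> /(exceed_act f c n x (D_chain (leqnSn m) Di)).
rewrite -(mean_average_indic bc mE invE) -(mean_cst P 0) mean_le//.
- exact: bounded_mfun_cst.
- apply: bounded_mfunM; last exact: bounded_mfun_indic.
  exact: bounded_average.
move=> x; rewrite indicE.
case: (boolP (x \in E)) => [/set_mem[/= cx _]|_]; last by rewrite mulr0.
rewrite mulr1; have -> : average m (fun y => f y - c) x = average m f x - c.
  rewrite -[in RHS](average_cst m c x) /average !fsbig_finite// big_split/=.
  by rewrite mulrDr sumrN mulrN.
by rewrite subr_ge0 ltW.
Qed.

Lemma limsup_average_le f c : bounded_mfun f -> \int[P]_x f x < c ->
  {ae P, forall x, exists m, forall n, (m <= n)%N -> average n f x <= c}.
Proof.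
move=> bf fc.
pose M m := \bigcup_n exceed f c m n; pose E := \bigcap_m M m.
have mM m : measurable (M m).
  by apply: bigcup_measurable => n _; exact: measurable_exceed.
have mE : measurable E by apply: bigcapT_measurable.
have ME m m' : (m <= m')%N -> M m' `<=` M m.
  move=> mm' x [n _ [j [/andP[mj jn] cj]]]; exists n => //; exists j.
  by rewrite (leq_trans mm').
have bc : bounded_mfun (fun x => f x - c).
  by apply: bounded_mfunD => //; exact: bounded_mfun_cst.
(* The sets [M m] decrease, so membership in [E] is decided by those of index at least [n], and
   these are unions of windows that are invariant under [D n]. *)
have invE n i : D n i -> act i @^-1` E = E.
  move=> Di; apply/seteqP; split=> x Ex m _.
    have [k _ Mk] := Ex (maxn m n) Logic.I; apply: (ME m (maxn m n)).
      exact: leq_maxl.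
    by exists k => //; apply/(exceed_act f c k x (D_chain (leq_maxr m n) Di)).
  have [k _ Mk] := Ex (maxn m n) Logic.I; apply: (ME m (maxn m n)).
    exact: leq_maxl.
  by exists k => //; apply/(exceed_act f c k x (D_chain (leq_maxr m n) Di)).
have [E0|E1] := act_ergodic mE invE.
  exists E; split=> // x /= nx; apply: contrapT => nEx; apply: nx.
  apply: contrapT => nx; apply: nEx => m _; apply: contrapT => nMx.
  apply: nx; exists m => n mn; rewrite leNgt; apply/negP => cx; apply: nMx.
  by exists n => //; exists n; rewrite mn leqnn.
exfalso; move: fc; apply/negP; rewrite -leNgt -subr_ge0.
have -> : \int[P]_x f x - c = \int[P]_x (f x - c).
  by rewrite mean_add ?mean_cst//; exact: bounded_mfun_cst.
have [_ [K Kf]] := bc.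
pose G n := exceed f c 0 n.
have mG n : measurable (G n) by exact: measurable_exceed.
(* On [G n] the maximal inequality gives a nonnegative integral; off [G n] the function [f - c] is
   at least [- K]. *)
have PG n : - K * (1 - fine (P (G n))) <= \int[P]_x (f x - c).
  have bG := bounded_mfun_indic R (mG n).
  have -> : \int[P]_x (f x - c) =
      \int[P]_x ((f x - c) * \1_(G n) x + (f x - c) * (1 - \1_(G n) x)).
    by apply: eq_Rintegral => x _; rewrite -mulrDr [X in _ * X]addrC subrK mulr1.
  have b1G : bounded_mfun (fun x => 1 - \1_(G n) x : R).
    apply: bounded_mfunD; first exact: bounded_mfun_cst.
    exact: bounded_mfunN.
  rewrite mean_add; [|exact: bounded_mfunM..].
  rewrite -[X in X <= _]add0r lerD ?maximal_inequality//.
  have -> : 1 - fine (P (G n)) = \int[P]_x (1 - \1_(G n) x).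
    rewrite mean_add; [|exact: bounded_mfun_cst|exact: bounded_mfunN].
    by rewrite mean_cst mean_opp// mean_indic.
  rewrite -mean_scale// mean_le//.
  - by apply: bounded_mfunM => //; exact: bounded_mfun_cst.
  - by apply: bounded_mfunM.
  move=> x; apply: ler_wpM2r.
    by rewrite indicE subr_ge0; case: (_ \in _).
  by move: (Kf x); rewrite ler_norml => /andP[].
(* The sets [G n] increase to [M 0], which contains the set [E] of full measure. *)
have cvgPG : fine (P (G n)) @[n --> \oo] --> (1 : R).
  have PM : P (M 0%N) = 1%E.
    apply/eqP; rewrite eq_le probability_le1//= -E1 le_measure ?inE//.
    by move=> x; exact.
  rewrite (_ : 1 = fine 1%E)//; apply/fine_cvg; rewrite -PM.
  apply: nondecreasing_cvg_mu => //; first exact: mM.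
  move=> n n' nn'; apply/subsetPset => x [j [/andP[_ jn] cj]].
  by exists j; rewrite leq0n (leq_trans jn).
have : (- K * (1 - fine (P (G n)))) @[n --> \oo] --> (- K * (1 - 1) : R).
  by apply: cvgMr; apply: cvgB => //; exact: cvg_cst.
rewrite subrr mulr0 => cvg0.
by apply: (cvgr_to_le cvg0); apply: nearW.
Qed.

(** The upper bound is applied to [f] and to [- f], with the mean plus [1/(k+1)] as threshold; there
    are countably many [k], so one null set serves for all of them. *)
Lemma average_cvg f : bounded_mfun f ->
  {ae P, forall x, average n f x @[n --> \oo] --> \int[P]_x f x}.
Proof.
move=> bf.
have up g (bg : bounded_mfun g) : {ae P, forall x, forall k : nat, exists m,
    forall n, (m <= n)%N -> average n g x <= \int[P]_x g x + k.+1%:R^-1}.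
  apply: ae_foralln => k; apply: limsup_average_le => //.
  by rewrite ltrDl invr_gt0.
have bN := bounded_mfunN bf.
move: (up _ bf) (up _ bN); apply: filterS2 => x xf xN.
apply/cvgrPdist_le => e e0.
have [k ke] : exists k, k.+1%:R^-1 < e.
  by have [k _ /(_ k (leqnn k))] := near_infty_natSinv_lt (PosNum e0); exists k.
have [m1 xm1] := xf k; have [m2 xm2] := xN k.
exists (maxn m1 m2) => // n /=; rewrite geq_max => /andP[/xm1 A1 /xm2].
rewrite averageN mean_opp// => A2; rewrite ler_norml lerBlDr lerBrDr.
apply/andP; split.
  rewrite addrC lerBlDr (le_trans A1)// lerD2l; exact: ltW.
move: A2; rewrite lerNl opprD opprK lerBlDr => /le_trans; apply.
by rewrite addrC lerD2r ltW.
Qed.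

End ErgodicAverages.

(** * Convergence and continuity in the complex numbers, by components *)

Section ComplexConvergence.
Variable R : realType.
Implicit Types z w : R[i].

Lemma ImD z w : complex.Im (z + w) = complex.Im z + complex.Im w.
Proof. by case: z w => [a b] [c e]. Qed.

Lemma ReD z w : complex.Re (z + w) = complex.Re z + complex.Re w.
Proof. by case: z w => [a b] [c e]. Qed.

Lemma normc_ge_Im z : `|complex.Im z|%:C <= `|z|.
Proof.
rewrite normc_def lecR -sqrtr_sqr ler_sqrt ?addr_ge0 ?sqr_ge0//.
by rewrite lerDr sqr_ge0.
Qed.

Lemma complex_cvg (F : set_system nat) {FF : Filter F} (u : nat -> R[i]) l :
    complex.Re (u n) @[n --> F] --> complex.Re l ->
    complex.Im (u n) @[n --> F] --> complex.Im l ->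
  (u : nat -> R[i]^o) @ F --> (l : R[i]^o).
Proof.
move=> /cvgrPdist_lt cRe /cvgrPdist_lt cIm; apply/cvgrPdist_lt => e e0.
(* The norm of [R[i]] takes its values in [R[i]], so [e] is a complex number; being positive it is
   real, and each component receives half of it. *)
have e'0 : 0 < complex.Re e / 2.
  by rewrite divr_gt0//; move: e0; rewrite ltcE => /andP[].
have eE : e = (complex.Re e)%:C.
  by case: e e0 {e'0} => a b; rewrite ltcE/= => /andP[/eqP-> _].
move: (cRe _ e'0) (cIm _ e'0); apply: filterS2 => n Ren Imn.
rewrite eE [l - u n]complexE (le_lt_trans (ler_normD _ _))//.
rewrite normrM (_ : `|'i%C| = 1 :> R[i]) ?mul1r; last first.
  by rewrite normc_def/= expr0n expr1n add0r sqrtr1.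
have normR (x : R) : `|x%:C| = (`|x|)%:C.
  by rewrite normc_def/= expr0n addr0 sqrtr_sqr.
rewrite !normR -rmorphD/= ltcR.
have subRe z w : complex.Re (z - w) = complex.Re z - complex.Re w.
  by case: z w => [a b] [c d].
have subIm z w : complex.Im (z - w) = complex.Im z - complex.Im w.
  by case: z w => [a b] [c d].
by rewrite subRe subIm [ltRHS]splitr ltrD.
Qed.

Lemma Re_continuous : continuous (@complex.Re R : R[i]^o -> R).
Proof.
move=> z; apply/(@cvgrPdist_lt _ _ _ (nbhs z)) => e e0.
have e'0 : 0 < e%:C :> R[i] by rewrite ltcR.
have : \forall w \near z, `|z - w| < e%:C.
  by have := nbhsx_ballx z _ e'0; rewrite -ball_normE.
apply: filterS => w; rewrite -ltcR; apply: le_lt_trans.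
by apply: le_trans (normc_ge_Re _); rewrite lecR; case: z w => [a b] [c d].
Qed.

Lemma Im_continuous : continuous (@complex.Im R : R[i]^o -> R).
Proof.
move=> z; apply/(@cvgrPdist_lt _ _ _ (nbhs z)) => e e0.
have e'0 : 0 < e%:C :> R[i] by rewrite ltcR.
have : \forall w \near z, `|z - w| < e%:C.
  by have := nbhsx_ballx z _ e'0; rewrite -ball_normE.
apply: filterS => w; rewrite -ltcR; apply: le_lt_trans.
by apply: le_trans (normc_ge_Im _); rewrite lecR; case: z w => [a b] [c d].
Qed.

End ComplexConvergence.

(** * The Pontryagin dual of a discrete abelian group, and its compactness *)

Section DualTheory.
Variables (R : realType) (V : zmodType).
Implicit Types (theta chi : pdual R V) (a b : V).

Lemma pdual_ext theta chi :
  pdual_eval theta =1 pdual_eval chi -> theta = chi.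
Proof. by move=> e; apply: val_inj; apply/funext => a; exact: e. Qed.

Lemma pdual_norm theta a : `|pdual_eval theta a| = 1.
Proof. by have [+ _] := set_mem (valP theta); exact. Qed.

Lemma pdual_evalD theta a b :
  pdual_eval theta (a + b) = pdual_eval theta a * pdual_eval theta b.
Proof. by have [_] := set_mem (valP theta); exact. Qed.

Lemma pdual_eval_neq0 theta a : pdual_eval theta a != 0.
Proof. by rewrite -normr_gt0 pdual_norm. Qed.

Lemma pdual_eval0 theta : pdual_eval theta 0 = 1.
Proof.
apply: (mulfI (pdual_eval_neq0 theta 0)).
by rewrite -pdual_evalD addr0 mulr1.
Qed.

Lemma pdual_evalJ theta a : (pdual_eval theta a)^* * pdual_eval theta a = 1.
Proof. by rewrite mulrC -sqr_normc pdual_norm expr1n. Qed.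

Lemma pdual_evalN theta a : pdual_eval theta (- a) = (pdual_eval theta a)^*.
Proof.
apply: (mulIf (pdual_eval_neq0 theta a)).
by rewrite -pdual_evalD addNr pdual_eval0 pdual_evalJ.
Qed.

Lemma pdual_evalB theta a b :
  pdual_eval theta (a - b) = pdual_eval theta a * (pdual_eval theta b)^*.
Proof. by rewrite pdual_evalD pdual_evalN. Qed.

Lemma pdual_evalMn theta a n :
  pdual_eval theta (a *+ n) = pdual_eval theta a ^+ n.
Proof.
elim: n => [|n IHn]; first by rewrite mulr0n pdual_eval0.
by rewrite mulrS exprS pdual_evalD IHn.
Qed.

Lemma pdual_make_subproof (f : V -> R[i]) :
    (forall a, `|f a| = 1) -> (forall a b, f (a + b) = f a * f b) ->
  (f : {ptws V -> R[i]^o}) \in @unitary_character R V.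
Proof. by move=> f1 fD; apply/mem_set. Qed.

Definition pdual_make f f1 fD : pdual R V :=
  exist (fun f' => f' \in @unitary_character R V) _
    (@pdual_make_subproof f f1 fD).

(** Two initial topologies are unfolded in turn: that of the product of copies of [R[i]], then that
    of the subspace of characters. *)
Lemma pdual_cvg (F : set_system (pdual R V)) theta : Filter F ->
    (forall a, pdual_eval x a @[x --> F] --> (pdual_eval theta a : R[i]^o)) ->
  F --> theta.
Proof.
move=> FF cF.
have cF' : (fun x : pdual R V => set_val x) @ F --> set_val theta.
  apply/cvg_sup => a A [_ [[W oW <-] /= Wt] WA].
  have FW : F [set x | W (pdual_eval x a)].
    exact: cF a W (open_nbhs_nbhs (conj oW Wt)).
  suff : F [set x | A (set_val x)] by [].
  by apply: filterS FW => x; exact: WA.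
move=> A [_ [[W oW <-] /= Wt] WA].
have FW : F [set x | W (set_val x)].
  exact: cF' W (open_nbhs_nbhs (conj oW Wt)).
suff : F A by [].
by apply: filterS FW => x; exact: WA.
Qed.

Lemma pdual_eval_continuous a :
  continuous ((fun theta => pdual_eval theta a) : pdual R V -> R[i]^o).
Proof.
move=> theta; apply: (@continuous_comp _ {ptws V -> R[i]^o} _ set_val (proj a)).
  exact: initial_continuous.
exact: proj_continuous.
Qed.

(** All values of characters are [n]-th roots of unity, hence lie in a finite set. Tychonoff's
    theorem makes the product of these finite sets compact, and the characters are closed in it. *)
Lemma pdual_compact (n : nat) : (0 < n)%N -> (forall a, a *+ n = 0) ->
  compact [set: pdual R V].
Proof.
move=> n0 nV.
pose K : set {ptws V -> R[i]^o} := [set f | forall a, [set z | z ^+ n = 1] (f a)].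
have cK : compact K.
  apply: (@tychonoff V (fun=> R[i]^o) (fun=> [set z | z ^+ n = 1])) => a.
  apply: finite_compact.
  have [rs rsE] := closed_field_poly_normal ('X^n - 1 : {poly R[i]}).
  apply: (@sub_finite_set _ _ [set` rs]) => // z /= zn1.
  have : root ('X^n - 1) z by rewrite rootE !hornerE zn1 subrr.
  by rewrite rsE rootZ ?root_prod_XsubC// lead_coef_eq0 -size_poly_gt0
    size_XnsubC.
have proj_cvg (f : {ptws V -> R[i]^o}) a :
    (fun g : {ptws V -> R[i]^o} => g a : R[i]^o) @ f --> (f a : R[i]^o).
  exact: (@proj_continuous V (fun=> R[i]^o) a f).
pose C : set {ptws V -> R[i]^o} := @unitary_character R V.
have clC : closed C.
  have -> : C = \bigcap_(ab in [set: V * V])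
      ((fun f : {ptws V -> R[i]^o} =>
         f (ab.1 + ab.2) - (f ab.1 : R[i]^o) * f ab.2 : R[i]^o) @^-1` [set 0] `&`
       (fun f : {ptws V -> R[i]^o} => `|f ab.1| - 1) @^-1` [set 0]).
    apply/seteqP; split=> [f [f1 fD] [a b] _|f fC]; split => /=.
    - by rewrite fD subrr.
    - by rewrite f1 subrr.
    - by move=> a; have [_ /eqP] := fC (a, a) Logic.I; rewrite /= subr_eq0 => /eqP.
    - by move=> a b; have [/eqP + _] := fC (a, b) Logic.I; rewrite /= subr_eq0 => /eqP.
  have cl0 : closed [set (0 : R[i]^o)].
    apply: accessible_closed_set1; apply: hausdorff_accessible.
    exact: norm_hausdorff.
  apply: closed_bigI => -[a b] _; apply: closedI.
    apply: preimage_closed cl0 => f _; have pc := proj_cvg f.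
    exact: cvgB (pc (a + b)) (cvgM (pc a) (pc b)).
  apply: preimage_closed cl0 => f _; have pc := proj_cvg f.
  exact: cvgB (cvg_norm (pc a)) (cvg_cst _).
have cC : compact C.
  apply: (subclosed_compact clC cK) => f Cf a.
  have := pdual_evalMn (exist _ f (mem_set Cf) : pdual R V) a n.
  by rewrite nV pdual_eval0.
(* The image filter has a cluster point in [C], which is a character; it is a cluster point of [F]
   because the topology of the dual is induced. *)
move=> F FF _.
have [|p [Cp Fp]] := cC (set_val @ F).
  suff : F [set x | C (set_val x)] by [].
  by apply: filterS filterT => x _; exact: set_valP.
exists (exist _ p (mem_set Cp)); split=> // A B FA [_ [[W oW <-] /= Wp] WB].
have FA' : F [set x | (set_val @` A) (set_val x)].
  by apply: filterS FA => x Ax; exists x.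
have [_ [[x Ax <-] Wx]] := Fp _ _ FA' (open_nbhs_nbhs (conj oW Wp)).
by exists x; split=> //; exact: WB.
Qed.

End DualTheory.

(** * Characters separate the points of a group of prime exponent *)

Section SeparatingCharacters.
Variables (R : realType) (V : zmodType) (p : nat).
Hypothesis p_prime : prime p.
Hypothesis p_kills : forall a : V, a *+ p = 0.
Implicit Types a b x y : V.

Lemma mulrz_prime_inv x (d : int) : ~~ (p%:Z %| d)%Z -> exists u, x = x *~ d *~ u.
Proof.
move=> pd; have [u [v uv]] := Bezoutz d p.
have g1 : gcdz d p = 1.
  apply/eqP; rewrite -/(coprimez d p) coprimez_sym coprimezE absz_nat.
  by rewrite prime_coprime// -dvdzE.
exists u; rewrite -mulrzA mulrC -[u * d](addrK (v * p)) uv g1 mulrzBr mulr1z.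
by rewrite mulrzA -pmulrn p_kills subr0.
Qed.

(** Any root of [1 + X + ... + X^(p-1)] will do: the value of this polynomial at 1 is [p], which is
    not 0. *)
Lemma root_of_unity_neq1 : exists2 z : R[i], z ^+ p = 1 & z != 1.
Proof.
have [k pk] : exists k, p = k.+2.
  by exists p.-2; rewrite -subn2 -addn2 subnK ?prime_gt1.
pose q : {poly R[i]} := \sum_(i < p) 'X^i.
have sq : size q != 1%N.
  have -> : q = \poly_(i < p) 1.
    by rewrite poly_def; apply: eq_bigr => i _; rewrite scale1r.
  by rewrite size_poly_eq ?oner_neq0// pk.
have [z /rootP qz] := closed_rootP q sq; exists z.
  apply/eqP; rewrite -subr_eq0 subrX1.
  suff -> : \sum_(i < p) z ^+ i = q.[z] by rewrite qz mulr0.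
  by rewrite horner_sum; apply: eq_bigr => i _; rewrite hornerXn.
apply/eqP => z1; move: qz; rewrite z1 horner_sum.
under eq_bigr do rewrite hornerXn expr1n.
rewrite sumr_const card_ord => /eqP.
by rewrite pnatr_eq0 pk.
Qed.

(** Zorn's lemma gives a subgroup [M] maximal among those avoiding [b]. The quotient by [M] is then
    cyclic of order [p], generated by the class of [b], and the character sends this class to a root
    of unity [z] other than 1. *)
Lemma pdual_separates b : b != 0 -> exists chi : pdual R V, pdual_eval chi b != 1.
Proof.
move=> b0.
pose P (M : set V) := (forall x y, M x -> M y -> M (x - y)) /\ ~ M b.
have [|M [[MB Mb] maxM]] := @Zorn_bigcup _ P.
  move=> F FP Ftot; split=> [x y [X FX Xx] [Y FY Yy]|[X FX Xb]]; last first.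
    by have [_ /(_ Xb)] := FP _ FX.
  have [XY|YX] := Ftot _ _ FX FY.
    by exists Y => //; have [+ _] := FP _ FY; apply => //; exact: XY.
  by exists X => //; have [+ _] := FP _ FX; apply => //; exact: YX.
(* The predicate [P] also holds of the empty set, which maximality excludes: a set closed under
   subtraction and lacking 0 is empty, and the zero subgroup is larger. *)
have M0 : M 0.
  apply: contrapT => nM0; apply: (maxM [set 0]).
    split; last by move=> /(_ 0 erefl).
    move=> x Mx; exfalso; apply: nM0; rewrite -(subrr x); exact: MB.
  split=> [x y -> ->|/= b0']; first by rewrite /= subrr.
  by move: b0; rewrite b0' eqxx.
have MN x : M x -> M (- x) by move=> Mx; rewrite -sub0r; exact: MB.
have MD x y : M x -> M y -> M (x + y).
  by move=> Mx My; rewrite -[y]opprK; apply: MB => //; exact: MN.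
have MZ x (i : int) : M x -> M (x *~ i).
  move=> Mx; have MZn n : M (x *+ n).
    by elim: n => [|n IHn]; rewrite ?mulr0n// mulrS; exact: MD.
  by case: i => n; rewrite ?NegzE ?mulrNz; [exact: MZn|apply/MN; exact: MZn].
have Mbp d : M (b *~ d) -> (p %| d)%Z.
  move=> Mbd; apply/negP => pd; apply: Mb.
  by have [u ->] := mulrz_prime_inv b (introN idP pd); exact: MZ.
(* If [x] is not in [M], maximality puts [b] in the subgroup generated by [M] and [x]; the
   coefficient of [x] is prime to [p], so the relation can be solved for [x]. *)
have Mex x : exists j : int, M (x - b *~ j).
  have [Mx|nMx] := pselect (M x); first by exists 0; rewrite mulr0z subr0.
  pose N : set V := [set y | exists i : int, M (y - x *~ i)].
  have NM : M `<` N.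
    split=> [y My|NM]; first by exists 0; rewrite mulr0z subr0.
    by apply: nMx; apply: NM; exists 1; rewrite mulr1z subrr.
  have [i Mi] : N b.
    apply: contrapT => nNb; apply: (maxM N) => //; split=> // y z [i Mi] [j Mj].
    exists (i - j); rewrite mulrzBr; have := MB _ _ Mi Mj.
    by rewrite !opprD !addrA opprK (addrAC _ _ (- z)).
  have pi : ~~ (p %| i)%Z.
    apply/negP => /dvdzP[q iq]; apply: Mb.
    by move: Mi; rewrite iq mulrzA -pmulrn p_kills subr0.
  have [u xu] := mulrz_prime_inv x pi; exists u.
  by rewrite {1}xu -mulrzBl -opprB; apply/MZ/MN.
have /choice[j Mj] : forall x, exists j : int, M (x - b *~ j) by [].
have [z zp z1] := root_of_unity_neq1.
have z0 : z != 0.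
  apply/eqP => z0; move/eqP: zp; rewrite z0 expr0n gtn_eqF ?prime_gt0//.
  by rewrite eq_sym oner_eq0.
have zpd d : (p %| d)%Z -> z ^ d = 1.
  by move=> /dvdzP[q ->]; rewrite mulrC -exprz_exp -exprnP zp exp1rz.
have zd d : M (b *~ d) -> z ^ d = 1 by move=> /Mbp/zpd.
have nz : `|z| = 1.
  apply/eqP; rewrite -(pexpr_eq1 (prime_gt0 p_prime))//.
  by rewrite -normrX zp normr1.
have f1 x : `|z ^ j x| = 1 
  by case: (j x) => n; rewrite /exprz ?normfV normrX nz expr1n ?invr1.
(* The exponents [j] are mere choices, but [b] times the difference [d] of the two exponents lies in
   [M], so [p] divides [d] and [z ^ d = 1]. *)
have fD x y : z ^ j (x + y) = z ^ j x * z ^ j y.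
  rewrite -expfzDr//; apply: (mulIf (expfz_neq0 (- (j x + j y)) z0)).
  rewrite -!expfzDr// subrr expr0z; apply: zd.
  rewrite mulrzBr mulrzDr.
  have -> : b *~ j (x + y) - (b *~ j x + b *~ j y) =
    (x - b *~ j x) + (y - b *~ j y) - (x + y - b *~ j (x + y)).
    by rewrite addrACA -opprD opprB [RHS]addrC addrA subrK.
  by apply: MB => //; apply: MD.
exists (pdual_make f1 fD).
have -> : pdual_eval (pdual_make f1 fD) b = z ^ j b by [].
suff -> : z ^ j b = z by [].
rewrite -{2}[z]expr1z; apply: (mulIf (expfz_neq0 (- 1) z0)).
rewrite -!expfzDr// subrr expr0z; apply: zd.
by rewrite mulrzBr mulr1z -opprB; apply: MN.
Qed.

End SeparatingCharacters.

(** * Expectations of bounded complex random variables *)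

Section ComplexMean.
Context d (T : measurableType d) (R : realType) (P : probability T R).
Implicit Types f g : T -> R[i].

Definition cbounded_mfun f :=
  bounded_mfun (fun x => complex.Re (f x)) /\
  bounded_mfun (fun x => complex.Im (f x)).

Definition cmean f : R[i] :=
  (\int[P]_x complex.Re (f x)) +i* (\int[P]_x complex.Im (f x)).

Lemma ReM (z w : R[i]) : complex.Re (z * w) =
  complex.Re z * complex.Re w - complex.Im z * complex.Im w.
Proof. by case: z w => [a b] [c e]. Qed.

Lemma ImM (z w : R[i]) : complex.Im (z * w) =
  complex.Re z * complex.Im w + complex.Im z * complex.Re w.
Proof. by case: z w => [a b] [c e]. Qed.

Lemma cbounded_mfunD f g : cbounded_mfun f -> cbounded_mfun g ->
  cbounded_mfun (fun x => f x + g x).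
Proof.
move=> [bfR bfI] [bgR bgI]; split.
  by under eq_fun do rewrite ReD; exact: bounded_mfunD.
by under eq_fun do rewrite ImD; exact: bounded_mfunD.
Qed.

Lemma cbounded_mfunZ c f : cbounded_mfun f -> cbounded_mfun (fun x => c * f x).
Proof.
move=> [bfR bfI].
have bZ b (h : T -> R) : bounded_mfun h -> bounded_mfun (fun x => b * h x).
  by apply: bounded_mfunM; exact: bounded_mfun_cst.
split.
  under eq_fun do rewrite ReM.
  by apply: bounded_mfunD; [|apply: bounded_mfunN]; exact: bZ.
under eq_fun do rewrite ImM.
by apply: bounded_mfunD; exact: bZ.
Qed.

Lemma cmeanD f g : cbounded_mfun f -> cbounded_mfun g ->
  cmean (fun x => f x + g x) = cmean f + cmean g.
Proof.
move=> [bfR bfI] [bgR bgI]; rewrite /cmean.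
under eq_Rintegral do rewrite ReD.
under [X in _ +i* X]eq_Rintegral do rewrite ImD.
by rewrite !mean_add.
Qed.

Lemma cmeanZ c f : cbounded_mfun f -> cmean (fun x => c * f x) = c * cmean f.
Proof.
move=> [bfR bfI]; rewrite /cmean.
have bZ b (h : T -> R) : bounded_mfun h -> bounded_mfun (fun x => b * h x).
  by apply: bounded_mfunM; exact: bounded_mfun_cst.
under eq_Rintegral do rewrite ReM.
under [X in _ +i* X]eq_Rintegral do rewrite ImM.
rewrite !mean_add ?mean_opp ?mean_scale//; try (by apply: bounded_mfunN; exact: bZ);
  try exact: bZ.
by case: c.
Qed.

Lemma cmean_cst c : cmean (fun=> c) = c.
Proof. by rewrite /cmean !mean_cst; case: c. Qed.

Lemma cbounded_mfun_cst c : cbounded_mfun (fun=> c).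
Proof. by split; exact: bounded_mfun_cst. Qed.

Lemma cbounded_mfun_sum (I : Type) (s : seq I) (c : I -> R[i]) (F : I -> T -> R[i]) :
  (forall i, cbounded_mfun (F i)) ->
  cbounded_mfun (fun x => \sum_(i <- s) c i * F i x).
Proof.
move=> bF; elim: s => [|i s IHs].
  by under eq_fun do rewrite big_nil; exact: cbounded_mfun_cst.
by under eq_fun do rewrite big_cons; apply: cbounded_mfunD => //; exact: cbounded_mfunZ.
Qed.

Lemma cmean_sum (I : Type) (s : seq I) (c : I -> R[i]) (F : I -> T -> R[i]) :
    (forall i, cbounded_mfun (F i)) ->
  cmean (fun x => \sum_(i <- s) c i * F i x) = \sum_(i <- s) c i * cmean (F i).
Proof.
move=> bF; elim: s => [|i s IHs].
  by under eq_fun do rewrite big_nil; rewrite cmean_cst big_nil.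
under eq_fun do rewrite big_cons; rewrite cmeanD ?cmeanZ ?IHs ?big_cons//.
  exact: cbounded_mfunZ.
exact: cbounded_mfun_sum.
Qed.

Lemma cmean_fsum (I : choiceType) (D : set I) (c : I -> R[i]) (F : I -> T -> R[i]) :
    finite_set D -> (forall i, cbounded_mfun (F i)) ->
  cmean (fun x => \sum_(i \in D) c i * F i x) = \sum_(i \in D) c i * cmean (F i).
Proof.
by move=> fD bF; under eq_fun do rewrite fsbig_finite//; rewrite cmean_sum// fsbig_finite.
Qed.

Lemma cbounded_mfun_indic (B : set T) : measurable B ->
  cbounded_mfun (fun x => (x \in B)%:R).
Proof.
move=> mB; split.
  rewrite (_ : (fun x => _) = \1_B :> (T -> R)); first exact: bounded_mfun_indic.
  by apply/funext => x; rewrite indicE; case: (x \in B).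
rewrite (_ : (fun x => _) = (fun=> 0) :> (T -> R)); first exact: bounded_mfun_cst.
by apply/funext => x; case: (x \in B).
Qed.

Lemma cmean_indic (B : set T) : measurable B ->
  cmean (fun x => (x \in B)%:R) = (fine (P B))%:C.
Proof.
move=> mB; rewrite -mean_indic// /cmean; congr (_ +i* _).
  by apply: eq_Rintegral => x _; rewrite indicE; case: (x \in B).
rewrite -[RHS](mean_cst P 0); apply: eq_Rintegral => x _.
by case: (x \in B).
Qed.

Lemma cmean_ge0 f : (forall x, 0 <= f x) -> 0 <= cmean f.
Proof.
move=> f0; rewrite /cmean lecE/=; apply/andP; split.
  rewrite -(mean_cst P 0); apply/eqP/eq_Rintegral => x _.
  by move: (f0 x); rewrite lecE => /andP[/eqP].
by apply: Rintegral_ge0 => x _; move: (f0 x); rewrite lecE => /andP[].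
Qed.

End ComplexMean.

(** This serves for invariant measures, with [Q = P], as well as for image measures, with [Q] the
    image of [P] under [phi]. *)
Lemma cmean_comp d (T : measurableType d) (R : realType) (P Q : probability T R) 
    (phi : T -> T) (f : T -> R[i]) :
    measurable_fun setT phi ->
    (forall B, measurable B -> P (phi @^-1` B) = Q B) -> cbounded_mfun f ->
  cmean P (fun x => f (phi x)) = cmean Q f.
Proof.
move=> mphi PQ [bR bI]; rewrite /cmean; congr (_ +i* _).
  exact: (mean_comp mphi PQ bR).
exact: (mean_comp mphi PQ bI).
Qed.


(** * Borel measurability on the dual *)

Section BorelDual.
Variables (R : realType).

Lemma borel_open (T : ptopologicalType) (U : set T) : open U ->
  measurable (U : set (borel T)).
Proof. by move=> oU; apply: sub_sigma_algebra. Qed.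

Lemma continuous_borel_measurable (T : ptopologicalType) (f : T -> R) :
  continuous f -> measurable_fun setT (f : borel T -> R).
Proof.
move=> cf; apply: (measurability _ (RGenOInfty.measurableE R)).
move=> /= _ [_ [a ->]] <-; rewrite setTI; apply: borel_open.
by apply: open_comp => [x _|]; [exact: cf|exact: interval_open].
Qed.

Lemma continuous_borel_borel (S T : ptopologicalType) (f : S -> T) :
  continuous f -> measurable_fun setT (f : borel S -> borel T).
Proof.
move=> cf; apply: (@measurability _ _ (borel S) (borel T) setT f (@open T)) => //.
move=> /= _ [U oU] <-; rewrite setTI; apply: borel_open.
by apply: open_comp => // x _; exact: cf.
Qed.

Lemma cbounded_pdual_eval (V : zmodType) (a : V) :
  cbounded_mfun (fun theta : borel (pdual R V) => pdual_eval (theta : pdual R V) a).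
Proof.
split; split.
- apply: continuous_borel_measurable => theta.
  apply: (@continuous_comp _ R[i]^o); last exact: Re_continuous.
  exact: pdual_eval_continuous.
- exists 1 => theta; rewrite -lecR; apply: le_trans (normc_ge_Re _) _.
  by rewrite pdual_norm.
- apply: continuous_borel_measurable => theta.
  apply: (@continuous_comp _ R[i]^o); last exact: Im_continuous.
  exact: pdual_eval_continuous.
- exists 1 => theta; rewrite -lecR; apply: le_trans (normc_ge_Im _) _.
  by rewrite pdual_norm.
Qed.

Lemma pdual_comp_continuous (U V : zmodType) (f : {additive U -> V}) :
  continuous (@pdual_comp R U V f).
Proof.
move=> theta; have fF : Filter (pdual_comp f @ theta) by apply: fmap_filter; exact: (nbhs_filter (theta : pdual R V)).
apply: (pdual_cvg fF) => a.
exact: (@pdual_eval_continuous R V (f a) theta).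
Qed.

End BorelDual.

(** * The algebra of sets of characters that depend on finitely many values *)

Section FinitelyDetermined.
Variables (R : realType) (V : zmodType).

(** One implication suffices, since [theta] and [chi] may be exchanged. *)
Definition finitely_determined (B : set (pdual R V)) :=
  exists s : seq V, forall theta chi : pdual R V,
    (forall a, a \in s -> pdual_eval theta a = pdual_eval chi a) ->
    B theta -> B chi.

Lemma finitely_determined0 : finitely_determined set0.
Proof. by exists [::]. Qed.

Lemma finitely_determinedC B : finitely_determined B -> finitely_determined (~` B).
Proof.
move=> [s sB]; exists s => theta chi tc nBt Bc; apply: nBt.
by apply: sB Bc => a /tc.
Qed.

Lemma finitely_determinedU B C : finitely_determined B -> finitely_determined C ->
  finitely_determined (B `|` C).
Proof.
move=> [s sB] [t tC]; exists (s ++ t) => theta chi tc [Bt|Ct].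
  by left; apply: sB Bt => a sa; apply: tc; rewrite mem_cat sa.
by right; apply: tC Ct => a ta; apply: tc; rewrite mem_cat ta orbT.
Qed.

(* A copy of the dual whose measurable sets are the finitely determined ones,
   on which the Caratheodory extension theorem is applied. *)
Definition cylinder_space : Type := pdual R V.

HB.instance Definition _ := Pointed.copy cylinder_space (pdual R V).
HB.instance Definition _ := @isAlgebraOfSets.Build default_measure_display
  cylinder_space finitely_determined finitely_determined0
  finitely_determinedU finitely_determinedC.

End FinitelyDetermined.

Lemma fsum_delta (R : idomainType) (I : choiceType) (D : set I) (F : I -> R) x :
  finite_set D -> D x -> \sum_(i \in D) F i * (i == x)%:R = F x.
Proof.
move=> finD Dx; rewrite (fsbigD1 x)//= eqxx mulr1 fsbig1 ?addr0// => i [_ /eqP].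
by move=> /negPf ->; rewrite mulr0.
Qed.

Lemma fsum_mem (R : idomainType) (I : choiceType) (D : set I) x :
  finite_set D -> \sum_(i \in D) ((i == x)%:R : R) = (x \in D)%:R.
Proof.
move=> finD; case: (boolP (x \in D)) => [/set_mem Dx|/negP nDx].
  by rewrite -[RHS](fsum_delta (fun=> 1) finD Dx); under [RHS]eq_fsbigr do rewrite mul1r.
rewrite fsbig1// => i Di; case: eqP => // ix.
by exfalso; apply: nDx; rewrite -ix; exact/mem_set.
Qed.

(** * Fourier analysis on an increasing chain of finite subgroups *)

Section Restrictions.
Variables (R : realType) (V : zmodType) (p : nat) (W : nat -> set V).
Hypothesis p_prime : prime p.
Hypothesis p_kills : forall a : V, a *+ p = 0.
Hypothesis W_finite : forall n, finite_set (W n).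
Hypothesis W0 : forall n, W n 0.
Hypothesis WB : forall n a b, W n a -> W n b -> W n (a - b).
Implicit Types (theta chi : pdual R V) (a b : V).

Definition pdual_div_eval theta chi a := pdual_eval theta a * (pdual_eval chi a)^*.

Lemma pdual_div_norm theta chi a : `|pdual_div_eval theta chi a| = 1.
Proof. by rewrite normrM normcJ !pdual_norm mulr1. Qed.

Lemma pdual_divD theta chi a b : pdual_div_eval theta chi (a + b) =
  pdual_div_eval theta chi a * pdual_div_eval theta chi b.
Proof. by rewrite /pdual_div_eval !pdual_evalD rmorphM/= mulrACA. Qed.

Definition pdual_div theta chi : pdual R V :=
  pdual_make (pdual_div_norm theta chi) (pdual_divD theta chi).

Lemma pdual_divE theta chi a :
  pdual_eval (pdual_div theta chi) a = pdual_eval theta a * (pdual_eval chi a)^*.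
Proof. by []. Qed.

Lemma subgroup_opp n a : W n a -> W n (- a).
Proof. by move=> Wa; rewrite -sub0r; exact: WB. Qed.

Lemma subgroup_add n a b : W n a -> W n b -> W n (a + b).
Proof. by move=> Wa Wb; rewrite -[b]opprK; apply: WB => //; exact: subgroup_opp. Qed.

Lemma subgroup_shift n b : W n b -> set_bij (W n) (W n) (+%R^~ b).
Proof.
move=> Wb; split=> [a Wa|a a' _ _ /addIr//|a Wa]; first exact: subgroup_add.
by exists (a - b); [exact: WB | rewrite subrK].
Qed.

Definition card_level n : R[i] := #|` fset_set (W n)|%:R.

Lemma card_level_gt0 n : 0 < card_level n.
Proof.
rewrite ltr0n lt0n cardfs_eq0; apply/eqP => Wn0.
by move: (mem_set (W0 n)); rewrite -in_fset_set// Wn0.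
Qed.

Lemma card_level_neq0 n : card_level n != 0.
Proof. by rewrite gt_eqF ?card_level_gt0. Qed.

Lemma sum_cst_level n (c : R[i]) : \sum_(a \in W n) c = card_level n * c.
Proof.
by rewrite fsbig_finite// big_const_seq count_predT iter_addr_0 /card_level mulr_natl.
Qed.

(** Extension by 0 keeps the restrictions of all levels in the single type [V -> R[i]]. *)
Definition restr n theta a := if a \in W n then pdual_eval theta a else 0.

Lemma restrE n theta a : W n a -> restr n theta a = pdual_eval theta a.
Proof. by move=> Wa; rewrite /restr mem_set. Qed.

Lemma restr_eq n theta chi : restr n theta = restr n chi <->
  forall a, W n a -> pdual_eval theta a = pdual_eval chi a.
Proof.
split=> [tc a Wa|tc].
  by move: (congr1 (@^~ a) tc); rewrite /= !restrE.
by apply/funext => a; rewrite /restr; case: ifPn => // /set_mem/tc.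
Qed.

(** If [theta b] differs from 1 for some [b] in [W n], translation by [b] multiplies the sum by
    [theta b] and yet permutes its terms, so the sum is 0. *)
Lemma character_sum n theta :
  \sum_(a \in W n) pdual_eval theta a =
  card_level n * `[< forall a, W n a -> pdual_eval theta a = 1 >]%:R.
Proof.
case: asboolP => [t1|/existsNP[b /not_implyP[Wb /eqP tb]]].
  rewrite -sum_cst_level; apply: eq_fsbigr => a /set_mem; exact: t1.
rewrite mulr0; have e : \sum_(a \in W n) pdual_eval theta a =
    (\sum_(a \in W n) pdual_eval theta a) * pdual_eval theta b.
  rewrite {1}(reindex_fsbig _ _ _ _ (subgroup_shift Wb)) mulr_fsuml.
  by apply: eq_fsbigr => a _; rewrite pdual_evalD.
apply: contraNeq tb => s0.
by apply/eqP; apply: (mulfI s0); rewrite -e mulr1.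
Qed.

(** This is [character_sum] for the quotient of [theta] by [chi]. It writes the indicator of a class
    of characters with a given restriction as a finite combination of evaluations. *)
Lemma restr_indicator n theta chi :
  (card_level n)^-1 * \sum_(a \in W n) restr n theta a * (restr n chi a)^* =
  (restr n theta == restr n chi)%:R.
Proof.
have -> : \sum_(a \in W n) restr n theta a * (restr n chi a)^* =
    \sum_(a \in W n) pdual_eval (pdual_div theta chi) a.
  by apply: eq_fsbigr => a /set_mem Wa; rewrite !restrE.
rewrite character_sum mulKf ?card_level_neq0//; congr (_%:R); apply: f_equal.
apply/asboolP/eqP => [tc|/restr_eq tc a Wa].
  apply/restr_eq => a Wa; apply: (mulIf (x := (pdual_eval chi a)^*)).
    by rewrite conjc_eq0 pdual_eval_neq0.
  by rewrite -pdual_divE tc// mulrC pdual_evalJ.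
by rewrite pdual_divE tc// mulrC pdual_evalJ.
Qed.

(** By [restr_indicator] the indicator of the class is continuous; as it takes only the values 0 and
    1, the class is where it exceeds 1/2. *)
Lemma restr_class_open n theta : open [set chi | restr n chi = restr n theta].
Proof.
pose f chi := complex.Re
  ((card_level n)^-1 * \sum_(a <- fset_set (W n)) pdual_eval chi a * (pdual_eval theta a)^*).
have fE chi : f chi = (restr n chi == restr n theta)%:R.
  rewrite /f -fsbig_finite//.
  rewrite (_ : \sum_(a \in W n) _ = \sum_(a \in W n) restr n chi a * (restr n theta a)^*).
    by rewrite restr_indicator; case: (_ == _).
  by apply: eq_fsbigr => a /set_mem Wa; rewrite !restrE.
have cf : continuous f.
  have cE (s : seq V) : continuous (fun chi : pdual R V =>
      \sum_(a <- s) pdual_eval chi a * (pdual_eval theta a)^* : R[i]^o).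
    elim: s => [|a s IHs].
      by under eq_fun do rewrite big_nil; exact: cst_continuous.
    under eq_fun do rewrite big_cons; move=> chi.
    exact: cvgD (cvgM (@pdual_eval_continuous R V a chi) (cvg_cst _)) (IHs chi).
  move=> chi; rewrite /f; apply: (@continuous_comp _ R[i]^o); last exact: Re_continuous.
  exact: cvgM (cvg_cst _) (cE _ chi).
rewrite (_ : [set _ | _] = f @^-1` [set x | 2^-1 < x]).
  by apply: open_comp; [move=> chi _; exact: cf | exact: open_gt].
apply/seteqP; split=> chi /=; rewrite fE.
  by move=> ->; rewrite eqxx invf_lt1 ?ltr1n.
by case: eqP => // _; rewrite ltNge invr_ge0 ler0n.
Qed.

Definition restrictions n : set (V -> R[i]) := range (restr n).

(** The classes of equal restriction form an open cover of the compact dual, and a finite subcover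
    meets every restriction. *)
Lemma restrictions_finite n : finite_set (restrictions n).
Proof.
have := @pdual_compact R V p (prime_gt0 p_prime) p_kills.
rewrite compact_cover => /(_ (pdual R V) setT
  (fun theta => [set chi | restr n chi = restr n theta]))[theta _||D _ covD].
- exact: restr_class_open.
- by move=> theta _; exists theta.
apply: (@sub_finite_set _ _ (restr n @` [set` D])); last exact: finite_image.
by move=> _ [theta _ <-]; have [chi Dchi /= ->] := covD theta Logic.I; exists chi.
Qed.

Lemma restrictions_twist n chi : set_bij (restrictions n) (restrictions n) (fun r a => r a * (pdual_eval chi a)^*).
Proof.
have rd theta : (fun a => restr n theta a * (pdual_eval chi a)^*) = restr n (pdual_div theta chi).
  by apply/funext => a; rewrite /restr; case: ifPn; rewrite ?mul0r.
split=> [_ [theta _ <-]|r r' _ _ e|_ [theta _ <-]].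
- by rewrite rd; exists (pdual_div theta chi).
- apply/funext => a; apply: (mulIf (x := (pdual_eval chi a)^*)).
    by rewrite conjc_eq0 pdual_eval_neq0.
  exact: (congr1 (@^~ a) e).
(* The point of the dual is the trivial character, so this divides [theta] by the inverse of [chi],
   that is, multiplies it by [chi]. *)
exists (restr n (pdual_div theta (pdual_div point chi))).
  by exists (pdual_div theta (pdual_div point chi)).
apply: etrans (rd _) _; apply/restr_eq => a _.
have p1 : pdual_eval (point : pdual R V) a = 1 by [].
by rewrite !pdual_divE p1 mul1r conjCK -mulrA [_ * _^*]mulrC pdual_evalJ mulr1.
Qed.

(** For nonzero [a], a character [chi] with [chi a] different from 1 twists the restrictions among
    themselves and multiplies the sum by the conjugate of [chi a], so the sum is 0. *)
Lemma restr_sum n a : W n a ->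
  \sum_(r \in restrictions n) r a = \sum_(r \in restrictions n) (1 : R[i]) * (a == 0)%:R.
Proof.
move=> Wa; have [->|a0] := eqVneq a 0.
  by apply: eq_fsbigr => r /set_mem[theta _ <-]; rewrite restrE// pdual_eval0 mul1r.
under [RHS]eq_fsbigr do rewrite mulr0.
rewrite [RHS]fsbig1//.
have [chi chi1] := pdual_separates R p_prime p_kills a0.
apply: contraNeq chi1 => s0; apply/eqP; rewrite -[LHS]conjCK -[RHS]conjC1.
congr (_ ^*); apply: (mulfI s0); rewrite mulr1 mulr_fsuml.
by rewrite [RHS](reindex_fsbig _ _ _ _ (restrictions_twist n chi)).
Qed.

(** The sum of [r a] over all [r] and [a] is computed twice: summing over [r] first leaves only
    [a = 0], summing over [a] first leaves only the trivial restriction. *)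
Lemma card_restrictions n : \sum_(r \in restrictions n) (1 : R[i]) = card_level n.
Proof.
have finR := restrictions_finite n.
transitivity (\sum_(a \in W n) \sum_(r \in restrictions n) r a).
  rewrite -[LHS](fsum_delta (fun=> \sum_(r \in restrictions n) (1 : R[i])) (W_finite n) (W0 n)).
  by apply: eq_fsbigr => a /set_mem Wa; rewrite restr_sum// mulr_fsuml.
rewrite exchange_fsbig//.
have Rpoint : restrictions n (restr n point) by exists point.
rewrite -[RHS](fsum_delta (fun=> card_level n) finR Rpoint); apply: eq_fsbigr => r.
move=> /set_mem[theta _ <-]; rewrite -restr_indicator mulVKf ?card_level_neq0//.
by apply: eq_fsbigr => a /set_mem Wa; rewrite !restrE// conjC1 mulr1.
Qed.

Lemma restr_orthogonal n a : W n a -> \sum_(r \in restrictions n) r a = card_level n * (a == 0)%:R.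
Proof. by move=> Wa; rewrite restr_sum// -mulr_fsuml card_restrictions. Qed.

Section FourierCoefficients.
Variable psi : V -> R[i].
Hypothesis psi_pd : forall n (a : 'I_n -> V) (c : 'I_n -> R[i]),
  0 <= \sum_(i < n) \sum_(j < n) c i * (c j)^* * psi (a i - a j).
Hypothesis psi0 : psi 0 = 1.

Definition coef n (r : V -> R[i]) : R[i] :=
  (card_level n)^-1 * \sum_(a \in W n) psi a * (r a)^*.

(** Positive definiteness is used at the points of [W n] with the conjugate values of [theta] as
    coefficients; after the shift of [a] by [b], the double sum is the square of [card_level n]
    times the coefficient. *)
Lemma coef_ge0 n r : restrictions n r -> 0 <= coef n r.
Proof.
move=> [theta _ <-]; set s := fset_set (W n).
rewrite mulr_ge0// ?invr_ge0 ?(ltW (card_level_gt0 n))//.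
rewrite -(pmulr_rge0 _ (card_level_gt0 n)) -sum_cst_level.
have := psi_pd (fun i : 'I_(size s) => s`_i)
  (fun i : 'I_(size s) => (pdual_eval theta s`_i)^*).
congr (_ <= _).
transitivity (\sum_(b \in W n) \sum_(a \in W n)
    (pdual_eval theta a)^* * pdual_eval theta b * psi (a - b)).
  rewrite exchange_fsbig// fsbig_finite// -/s (big_nth 0) big_mkord.
  apply: eq_bigr => i _; rewrite fsbig_finite// -/s (big_nth 0) big_mkord.
  by apply: eq_bigr => j _; rewrite conjCK.
apply: eq_fsbigr => b /set_mem Wb.
rewrite (reindex_fsbig _ _ _ _ (subgroup_shift Wb)); apply: eq_fsbigr => a /set_mem Wa.
rewrite restrE// addrK pdual_evalD rmorphM/=.
by rewrite -[_ * pdual_eval theta b]mulrA pdual_evalJ mulr1 mulrC.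
Qed.

(** Fourier inversion on [W n]: after exchanging the sums, orthogonality at [a - b] keeps only the
    term [b = a]. *)
Lemma coef_inversion n a : W n a -> \sum_(r \in restrictions n) r a * coef n r = psi a.
Proof.
move=> Wa; have finR := restrictions_finite n.
transitivity (\sum_(b \in W n)
  \sum_(r \in restrictions n) (card_level n)^-1 * (psi b * (r a * (r b)^*))).
  rewrite exchange_fsbig//; apply: eq_fsbigr => r _.
  rewrite /coef mulrCA mulr_fsumr mulr_fsumr; apply: eq_fsbigr => b _.
  by congr (_ * _); rewrite mulrCA.
rewrite -[RHS](fsum_delta psi (W_finite n) Wa); apply: eq_fsbigr => b /set_mem Wb.
rewrite -!mulr_fsumr.
have -> : \sum_(r \in restrictions n) r a * (r b)^* = \sum_(r \in restrictions n) r (a - b).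
  apply: eq_fsbigr => _ /set_mem[theta _ <-].
  by rewrite !restrE//; [rewrite pdual_evalB | exact: WB].
rewrite restr_orthogonal; last exact: WB.
by rewrite mulrCA mulKf ?card_level_neq0// subr_eq0 eq_sym.
Qed.

Definition cylinder_level n (B : set (pdual R V)) :=
  forall theta chi, restr n theta = restr n chi -> B theta -> B chi.

Definition cylinder_mass n (B : set (pdual R V)) :=
  \sum_(r \in restr n @` B) coef n r.

Lemma restr_image_finite n (B : set (pdual R V)) : finite_set (restr n @` B).
Proof.
by apply: sub_finite_set (restrictions_finite n) => _ [theta _ <-]; exists theta.
Qed.

Lemma cylinder_mass_ge0 n B : 0 <= cylinder_mass n B.
Proof.
by apply: fsumr_ge0 => _ [theta _ <-]; apply: coef_ge0; exists theta.
Qed.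

Lemma cylinder_massT n : cylinder_mass n setT = 1.
Proof.
rewrite -psi0 -(coef_inversion (W0 n)); apply: eq_fsbigr => r /set_mem[theta _ <-].
by rewrite restrE// pdual_eval0 mul1r.
Qed.

(** A restriction common to both sets would put a point of [C] in [B], as [B] has level [n]; hence
    the two sums run over disjoint sets. *)
Lemma cylinder_massU n B C : cylinder_level n B -> [disjoint B & C]%classic ->
  cylinder_mass n (B `|` C) = cylinder_mass n B + cylinder_mass n C.
Proof.
move=> lB BC; rewrite /cylinder_mass image_setU fsbigU//=; try exact: restr_image_finite.
move=> _ [[theta Bt <-] [chi Cc ct]]; exfalso.
have : (B `&` C) chi by split=> //; exact: lB (esym ct) Bt.
by move/disj_setPS: BC => BC /BC.
Qed.

Lemma restr_mem n (B : set (pdual R V)) theta : cylinder_level n B ->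
  (restr n theta \in restr n @` B) = (theta \in B).
Proof.
move=> lB; apply/idP/idP => [/set_mem[chi Bc ct]|/set_mem Bt].
  by apply/mem_set; exact: lB ct Bc.
by apply/mem_set; exists theta.
Qed.

(** Consistency of the masses between levels. The indicator of [B] is expanded in evaluations at
    points of [W m] by [restr_indicator]; summed against the coefficients of level [n], each
    evaluation gives back [psi] by inversion, which leaves the coefficients of level [m]. *)
Lemma cylinder_mass_level m n B : cylinder_level m B -> (forall a, W m a -> W n a) ->
  cylinder_mass n B = cylinder_mass m B.
Proof.
move=> lB Wmn; have finR := restrictions_finite n.
have fB := restr_image_finite m B.
have lnB : cylinder_level n B.
  move=> theta chi /restr_eq tc; apply: lB; apply/restr_eq => a Wa.
  exact/tc/Wmn.
transitivity (\sum_(r \in restrictions n) (r \in restr n @` B)%:R * coef n r).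
  rewrite /cylinder_mass; have {1}-> : restr n @` B = restrictions n `&` restr n @` B.
    by apply/esym/setIidr => _ [theta _ <-]; exists theta.
  rewrite fsbig_mkcondr; apply: eq_fsbigr => r _.
  by case: ifPn => _; rewrite ?mul1r ?mul0r.
transitivity (\sum_(r \in restrictions n) \sum_(s \in restr m @` B) \sum_(a \in W m)
    (card_level m)^-1 * ((s a)^* * (r a * coef n r))).
  apply: eq_fsbigr => _ /set_mem[theta _ <-].
  rewrite restr_mem// -(restr_mem _ lB) -fsum_mem// mulr_fsuml.
  apply: eq_fsbigr => _ /set_mem[chi _ <-].
  rewrite eq_sym -restr_indicator -mulr_fsumr -mulrA; congr (_ * _).
  rewrite mulr_fsuml; apply: eq_fsbigr => a /set_mem Wa.
  have Wna := Wmn _ Wa; rewrite !restrE//.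
  by rewrite -mulrA mulrCA.
rewrite exchange_fsbig//; apply: eq_fsbigr => s _.
rewrite exchange_fsbig// /coef mulr_fsumr; apply: eq_fsbigr => a /set_mem Wa.
rewrite -!mulr_fsumr coef_inversion; last exact: Wmn.
by rewrite [X in _ * X]mulrC.
Qed.

End FourierCoefficients.

Hypothesis W_chain : forall m n, (m <= n)%N -> W m `<=` W n.
Hypothesis W_cover : forall a, exists n, W n a.

Lemma seq_in_level (s : seq V) : exists n, forall a, a \in s -> W n a.
Proof.
elim: s => [|b s [n sn]]; first by exists 0%N.
have [m Wb] := W_cover b; exists (maxn m n) => a.
rewrite inE => /predU1P[->|/sn Wa]; first exact: W_chain (leq_maxl m n) _ Wb.
exact: W_chain (leq_maxr m n) _ Wa.
Qed.

Lemma cylinder_level_mono m n B : (m <= n)%N -> cylinder_level m B -> cylinder_level n B.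
Proof.
move=> mn lB theta chi /restr_eq tc; apply: lB; apply/restr_eq => a Wa.
exact/tc/(W_chain mn).
Qed.

Lemma finitely_determinedP (B : set (pdual R V)) :
  finitely_determined B <-> exists n, cylinder_level n B.
Proof.
split=> [[s sB]|[n lB]].
  have [n Wn] := seq_in_level s; exists n => theta chi /restr_eq tc.
  by apply: sB => a /Wn/tc.
exists (fset_set (W n)) => theta chi tc; apply: lB; apply/restr_eq => a Wa.
by apply: tc; rewrite in_fset_set// mem_set.
Qed.

Lemma cylinder_level_open n B : cylinder_level n B -> open B.
Proof.
move=> lB; have -> : B = \bigcup_(theta in B) [set chi | restr n chi = restr n theta].
  apply/seteqP; split=> [theta Bt|chi [theta Bt ct]]; first by exists theta.
  exact: lB (esym ct) Bt.
by apply: bigcup_open => theta _; exact: restr_class_open.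
Qed.

Lemma finitely_determined_open (B : set (pdual R V)) : finitely_determined B -> open B.
Proof. by move=> /finitely_determinedP[n]; exact: cylinder_level_open. Qed.

(** Otherwise there are characters outside [U] that agree with [theta] on [W n], one for each [n];
    they converge pointwise to [theta], since every element lies in all [W n] from some level on. *)
Lemma restr_class_nbhs (U : set (pdual R V)) theta : nbhs theta U ->
  exists n, [set chi | restr n chi = restr n theta] `<=` U.
Proof.
move=> Ut; apply: contrapT => /forallNP nU.
have /choice[chi chiP] : forall n, exists chi,
    restr n chi = restr n theta /\ ~ U chi.
  move=> n; apply: contrapT => /forallNP nc; apply: (nU n) => chi ct.
  by apply: contrapT => nUc; apply: (nc chi).
suff : chi n @[n --> \oo] --> theta.
  by move=> /(_ _ Ut) [N _ /(_ N (leqnn N))]; have [] := chiP N.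
refine (@pdual_cvg R V (chi @ \oo) theta _ _) => a.
have [m Wa] := W_cover a.
move=> Q /nbhs_singleton Qa; exists m => // n /= mn.
have [/restr_eq e _] := chiP n.
by rewrite /= e//; exact: W_chain mn _ Wa.
Qed.

Lemma open_bigcup_cylinder (U : set (pdual R V)) : open U ->
  exists F : nat -> set (pdual R V),
    (forall n, finitely_determined (F n)) /\ U = \bigcup_n F n.
Proof.
move=> oU.
exists (fun n => [set theta | [set chi | restr n chi = restr n theta] `<=` U]).
split=> [n|].
  by apply/finitely_determinedP; exists n => theta chi e /= tU x xc; apply: tU; rewrite /= xc e.
apply/seteqP; split=> [theta Ut|theta [n _]]; last exact.
have [n nU] := restr_class_nbhs (open_nbhs_nbhs (conj oU Ut)).
by exists n.
Qed.

(** Open sets are countable unions of finitely determined sets. This identifies the domain of the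
    Caratheodory extension with the Borel sets. *)
Lemma borel_finitely_determined :
  @measurable _ (borel (pdual R V)) = <<s @finitely_determined R V >>.
Proof.
apply/seteqP; split; apply: smallest_sub; try exact: smallest_sigma_algebra.
  move=> U /open_bigcup_cylinder[F [fF ->]].
  by apply: sigma_algebra_bigcup => n; apply: sub_sigma_algebra.
by move=> B /finitely_determined_open oB; apply: sub_sigma_algebra.
Qed.

Lemma pdual_hausdorff : hausdorff_space (pdual R V).
Proof.
rewrite open_hausdorff => theta chi tc.
have [a ta] : exists a, pdual_eval theta a <> pdual_eval chi a.
  apply: contrapT => /forallNP e; move/eqP: tc; apply; apply: pdual_ext => a.
  by apply: contrapT; exact: e.
have [n Wa] := W_cover a.
exists ([set x | restr n x = restr n theta], [set x | restr n x = restr n chi]).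
  by split; exact/mem_set.
split; [exact: restr_class_open..|].
by apply/eqP/seteqP; split=> // x [/= -> /restr_eq/(_ _ Wa)].
Qed.

(** When [V] is a nil algebra, [xi_measure mu g] is convertible to [fourier mu (sub1 g)]. *)
Definition fourier (mu : probability (borel (pdual R V)) R) (a : V) : R[i] :=
  cmean mu (fun theta : borel (pdual R V) => pdual_eval (theta : pdual R V) a).

Definition restr_class n r : set (pdual R V) := [set theta | restr n theta = r].

Lemma restr_class_level n r : cylinder_level n (restr_class n r).
Proof. by move=> theta chi e /= <-. Qed.

Lemma restr_class_measurable n r :
  measurable (restr_class n r : set (borel (pdual R V))).
Proof. exact: borel_open (cylinder_level_open (@restr_class_level n r)). Qed.

(** Evaluation at [a] is constant on each of the finitely many classes of level [n], so its integral
    is a finite sum. *)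
Lemma fourier_cylinder (mu : probability (borel (pdual R V)) R) n a : W n a ->
  fourier mu a = \sum_(r \in restrictions n) r a * (fine (mu (restr_class n r)))%:C.
Proof.
move=> Wa; have finR := restrictions_finite n.
rewrite /fourier.
have -> : (fun theta : borel (pdual R V) => pdual_eval (theta : pdual R V) a) =
    (fun theta => \sum_(r \in restrictions n) r a * (theta \in restr_class n r)%:R).
  apply/funext => theta; have Rtheta : restrictions n (restr n theta) by exists theta.
  rewrite -(restrE theta Wa) -(fsum_delta (fun r => r a) finR Rtheta).
  apply: eq_fsbigr => r _; congr (_ * _%:R); apply: f_equal.
  by apply/eqP/idP => [->|/set_mem//]; exact/mem_set.
rewrite cmean_fsum//; last first.
  move=> r; apply: (@cbounded_mfun_indic _ (borel (pdual R V)) R (restr_class n r)).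
  exact: restr_class_measurable.
apply: eq_fsbigr => r _; congr (_ * _).
apply: (@cmean_indic _ (borel (pdual R V)) R mu (restr_class n r)).
exact: restr_class_measurable.
Qed.

(** * Bochner's theorem, by extension of the cylinder masses, and uniqueness *)

Section Bochner.
Variable psi : V -> R[i].
Hypothesis psi_pd : forall n (a : 'I_n -> V) (c : 'I_n -> R[i]),
  0 <= \sum_(i < n) \sum_(j < n) c i * (c j)^* * psi (a i - a j).
Hypothesis psi0 : psi 0 = 1.

(** Some level of [B] is chosen, with 0 as default; by [cylinder_mass_level] the choice does not
    affect the value. The masses are nonnegative, so passing to the real part loses nothing. *)
Definition cylinder_premeasure (B : set (cylinder_space R V)) : \bar R :=
  (complex.Re (cylinder_mass psi (xget 0%N [set n | cylinder_level n B]) B))%:E.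

Lemma cylinder_premeasureE n (B : set (cylinder_space R V)) : cylinder_level n B ->
  cylinder_premeasure B = (complex.Re (cylinder_mass psi n B))%:E.
Proof.
move=> lB; rewrite /cylinder_premeasure; set m := xget _ _.
have lmB : cylinder_level m B.
  by apply: (@xgetPex _ 0%N [set n | cylinder_level n B]); exists n.
rewrite -(cylinder_mass_level psi lmB (W_chain (leq_maxl m n))).
by rewrite -(cylinder_mass_level psi lB (W_chain (leq_maxr m n))).
Qed.

Lemma cylinder_premeasure0 : cylinder_premeasure set0 = 0%E.
Proof. by rewrite /cylinder_premeasure /cylinder_mass image_set0 fsbig_set0. Qed.

Lemma cylinder_premeasure_ge0 B : (0 <= cylinder_premeasure B)%E.
Proof.
rewrite lee_fin.
by have := cylinder_mass_ge0 psi_pd (xget 0%N [set n | cylinder_level n B]) B;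
  rewrite lecE => /andP[].
Qed.

Lemma cylinder_premeasureU (B C : set (cylinder_space R V)) :
  finitely_determined B -> finitely_determined C -> [disjoint B & C]%classic ->
  cylinder_premeasure (B `|` C) = (cylinder_premeasure B + cylinder_premeasure C)%E.
Proof.
move=> /finitely_determinedP[m mB] /finitely_determinedP[n nC] BC.
have lB := cylinder_level_mono (leq_maxl m n) mB.
have lC := cylinder_level_mono (leq_maxr m n) nC.
have lBC : cylinder_level (maxn m n) (B `|` C).
  move=> theta chi tc [Bt|Ct]; first by left; exact: lB Bt.
  by right; exact: lC Ct.
rewrite (cylinder_premeasureE lB) (cylinder_premeasureE lC).
by rewrite (cylinder_premeasureE lBC) -EFinD -ReD cylinder_massU.
Qed.

Lemma cylinder_premeasure_bigsetU (F : nat -> set (cylinder_space R V)) n :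
    (forall i, finitely_determined (F i)) -> trivIset setT F ->
  cylinder_premeasure (\big[setU/set0]_(i < n) F i) =
    (\sum_(i < n) cylinder_premeasure (F i))%E.
Proof.
move=> fF tF; elim: n => [|n IHn]; first by rewrite !big_ord0 cylinder_premeasure0.
rewrite !big_ord_recr /= cylinder_premeasureU ?IHn//.
  elim: n {IHn} => [|n IHn]; first by rewrite big_ord0; exact: finitely_determined0.
  by rewrite big_ord_recr; exact: finitely_determinedU.
apply/disj_setPS => theta [/= + Fn]; rewrite -bigcup_mkord => -[i /= ni Fi].
have /trivIsetP/(_ i n Logic.I Logic.I) := tF.
by rewrite ltn_eqF// => /(_ isT) /seteqP[+ _]; apply; split; [exact: Fi|].
Qed.

(** A finitely determined union is closed in the compact dual, hence compact, and the sets [F i] are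
    open; finitely many of them cover it, so countable additivity reduces to finite additivity. *)
Lemma cylinder_premeasure_sigma_additive : semi_sigma_additive cylinder_premeasure.
Proof.
move=> F mF tF mUF; set U := \bigcup_n F n.
have cU : compact (U : set (pdual R V)).
  apply: (@subclosed_compact _ _ [set: pdual R V]) => //.
    have := finitely_determined_open (finitely_determinedC mUF).
    by move=> /open_closedC; rewrite setCK.
  exact: pdual_compact (prime_gt0 p_prime) p_kills.
move: cU; rewrite compact_cover => /(_ nat setT F) [i _||D _ covD].
- exact: finitely_determined_open (mF i).
- exact: subset_refl.
(* The successor of the sum of all indices in [D] exceeds each of them. *)
have [N ND] : exists N, forall i, i \in D -> (i < N)%N.
  exists (\sum_(i <- D) i).+1 => i iD.
  by rewrite ltnS (big_rem i)//= leq_addr.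
(* From index [N] on, the partial unions are all of [U], so the partial sums equal their limit. *)
move=> Q /topology_structure.nbhs_singleton QU; exists N => // n /= Nn.
rewrite big_mkord -cylinder_premeasure_bigsetU//.
have -> // : \big[setU/set0]_(i < n) F i = U.
apply/seteqP; split=> theta; rewrite -bigcup_mkord.
  by move=> [i _ Fi]; exists i.
by move=> /covD[i /= Di Fi]; exists i => //=; exact: leq_trans (ND _ Di) Nn.
Qed.

HB.instance Definition _ := isMeasure.Build _ (cylinder_space R V) R
  cylinder_premeasure cylinder_premeasure0 cylinder_premeasure_ge0
  cylinder_premeasure_sigma_additive.

Definition bochner_measure (B : set (borel (pdual R V))) : \bar R :=
  measure_extension cylinder_premeasure B.

Lemma bochner_measure0 : bochner_measure set0 = 0%E.
Proof. exact: measure0. Qed.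

Lemma bochner_measure_ge0 B : (0 <= bochner_measure B)%E.
Proof. exact: measure_ge0. Qed.

Lemma bochner_measure_sigma_additive : semi_sigma_additive bochner_measure.
Proof.
move=> F mF tF mUF.
apply: (@measure_semi_sigma_additive _ _ _ (measure_extension cylinder_premeasure)) => //.
  by move=> i; have := mF i; rewrite borel_finitely_determined.
by move: mUF; rewrite borel_finitely_determined.
Qed.

HB.instance Definition _ := isMeasure.Build _ (borel (pdual R V)) R
  bochner_measure bochner_measure0 bochner_measure_ge0
  bochner_measure_sigma_additive.

Lemma bochner_measure_cylinder n (B : set (borel (pdual R V))) : cylinder_level n B ->
  bochner_measure B = (complex.Re (cylinder_mass psi n B))%:E.
Proof.
move=> lB; rewrite -(cylinder_premeasureE lB).
apply: (measurable_mu_extE cylinder_premeasure).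
by apply/finitely_determinedP; exists n.
Qed.

Lemma bochner_measureT : bochner_measure setT = 1%E.
Proof. by rewrite (@bochner_measure_cylinder 0)// cylinder_massT. Qed.

HB.instance Definition _ := Measure_isProbability.Build _ (borel (pdual R V)) R
  bochner_measure bochner_measureT.

(* The Caratheodory extension is the infimum of the masses of the countable
   covers by clopen sets, so it is outer regular by construction; inner
   regularity follows by taking complements in the compact dual. *)
Lemma bochner_measure_regular : regular_measure bochner_measure.
Proof.
have outer (B : set (borel (pdual R V))) : measurable B -> bochner_measure B =
    ereal_inf [set bochner_measure U | U in [set U : set (pdual R V) | open U /\ B `<=` U]].
  move=> mB; apply/eqP; rewrite eq_le; apply/andP; split.
    apply: le_ereal_inf_tmp => _ [U [oU BU] <-].
    by apply: le_measure; rewrite ?inE//; exact: borel_open.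
  rewrite {2}/bochner_measure /measure_extension /mu_ext.
  apply: le_ereal_inf_tmp => _ [F [fF BF] <-].
  have oF k : open (F k : set (pdual R V)).
    exact: (finitely_determined_open (fF k)).
  have oU : open (\bigcup_k F k : set (pdual R V)) by apply: bigcup_open => k _.
  apply: (@le_trans _ _ (bochner_measure (\bigcup_k F k))).
    by apply: ereal_inf_lbound; exists (\bigcup_k F k).
  have -> : (\sum_(k <oo) cylinder_premeasure (F k) =
             \sum_(k <oo) bochner_measure (F k))%E.
    apply: eq_eseriesr => k _; have [n lF] := (finitely_determinedP (F k)).1 (fF k).
    by rewrite (cylinder_premeasureE lF) (bochner_measure_cylinder lF).
  apply: measure_sigma_subadditive => //; last exact: borel_open.
  by move=> k; exact: borel_open.
move=> B mB; split; first exact: outer.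
have mC (U : set (pdual R V)) : open U -> measurable (~` U : set (borel (pdual R V))).
  by move=> oU; apply: measurableC; exact: borel_open.
have cC (U : set (pdual R V)) : open U -> compact (~` U).
  move=> oU; apply: (@subclosed_compact _ _ [set: pdual R V]) => //.
    exact: open_closedC.
  exact: pdual_compact (prime_gt0 p_prime) p_kills.
apply/eqP; rewrite eq_le; apply/andP; split; last first.
  apply: ge_ereal_sup => _ [K [cK KB] <-].
  apply: le_measure; rewrite ?inE//.
  have clK : closed K.
    by apply: compact_closed => //; exact: pdual_hausdorff.
  by rewrite -[K]setCK; apply: mC; exact: closed_openC.
have mB' : measurable (~` B) by exact: measurableC.
have PC (C : set (borel (pdual R V))) : measurable C ->
    bochner_measure (~` C) = (1 - bochner_measure C)%E.
  by move=> mC'; exact: (probability_setC bochner_measure mC').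
have PE (C : set (borel (pdual R V))) : measurable C ->
    bochner_measure C = (fine (bochner_measure C))%:E.
  by move=> mC'; rewrite fineK//; exact: (fin_num_measure bochner_measure).
apply/lee_addgt0Pr => e e0.
have [|_ [U [oU BU] <-]] := lb_ereal_inf_adherent e0 (S :=
    [set bochner_measure U | U in [set U : set (pdual R V) | open U /\ ~` B `<=` U]]).
  by rewrite -outer// PE.
rewrite -outer// => Ue; apply: (@le_trans _ _ (bochner_measure (~` U) + e%:E)%E).
  have mU : measurable (U : set (borel (pdual R V))) by exact: borel_open.
  move: Ue; rewrite !PC// (PE B)// (PE U)// -!EFinB -!EFinD lte_fin lee_fin.
  by move=> Ue; lra.
rewrite leeD2r//; apply: ereal_sup_ubound; exists (~` U) => //; split; first exact: cC.
by move=> x nUx; apply: contrapT => /BU.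
Qed.

(** The mass of a class is the Fourier coefficient of [psi] at its restriction, so the claim becomes
    [coef_inversion]. *)
Lemma bochner_fourier a : fourier bochner_measure a = psi a.
Proof.
have [n Wa] := W_cover a.
rewrite -(coef_inversion psi Wa) (fourier_cylinder _ Wa).
apply: eq_fsbigr => _ /set_mem[theta _ <-]; congr (_ * _).
transitivity (fine (bochner_measure (restr_class n (restr n theta))))%:C => //.
rewrite (bochner_measure_cylinder (@restr_class_level n _))/=.
have -> : cylinder_mass psi n (restr_class n (restr n theta)) = coef psi n (restr n theta).
  rewrite /cylinder_mass (_ : restr n @` _ = [set restr n theta]) ?fsbig_set1//.
  by apply/seteqP; split=> [_ [chi <- <-]//|_ ->]; exists theta.
have : 0 <= coef psi n (restr n theta) by apply: coef_ge0 => //; exists theta.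
by case: (coef _ _ _) => x y; rewrite lecE/= => /andP[/eqP-> _].
Qed.

Theorem bochner : exists mu : probability (borel (pdual R V)) R,
  regular_measure mu /\ fourier mu =1 psi.
Proof.
exists bochner_measure; split; first exact: bochner_measure_regular.
exact: bochner_fourier.
Qed.

End Bochner.

(** The indicator of [B] is a finite combination of evaluations, so the transform of [mu] determines
    the mass of [B]. *)
Lemma probability_cylinder (mu : probability (borel (pdual R V)) R) n B :
  cylinder_level n B -> (fine (mu B))%:C = cylinder_mass (fourier mu) n B.
Proof.
move=> lB; have fB := restr_image_finite n B.
have mB : measurable (B : set (borel (pdual R V))).
  exact: borel_open (cylinder_level_open lB).
rewrite -cmean_indic//.
pose F s (theta : borel (pdual R V)) :=
  \sum_(a \in W n) (card_level n)^-1 * (s a)^* * pdual_eval (theta : pdual R V) a.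
have -> : (fun theta => (theta \in B)%:R) =
    (fun theta => \sum_(s \in restr n @` B) 1 * F s theta).
  apply/funext => theta; rewrite -(restr_mem theta lB) -fsum_mem//.
  apply: eq_fsbigr => _ /set_mem[chi _ <-]; rewrite eq_sym -restr_indicator mul1r.
  rewrite mulr_fsumr; apply: eq_fsbigr => a /set_mem Wa.
  by rewrite !restrE// -mulrA [X in _ * X]mulrC.
have bF s : cbounded_mfun (F s).
  rewrite /F; under eq_fun do rewrite fsbig_finite//.
  by apply: cbounded_mfun_sum => a; exact: cbounded_pdual_eval.
rewrite cmean_fsum//; apply: eq_fsbigr => s _; rewrite mul1r.
rewrite /F cmean_fsum//; last by move=> a; exact: cbounded_pdual_eval.
rewrite /coef mulr_fsumr; apply: eq_fsbigr => a _.
by rewrite -mulrA [X in _ * X]mulrC.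
Qed.

(** The two probabilities agree on the finitely determined sets, which are stable under intersection
    and generate the Borel sets. *)
Lemma fourier_inj (mu nu : probability (borel (pdual R V)) R) :
  fourier mu =1 fourier nu -> forall B, measurable B -> mu B = nu B.
Proof.
move=> /funext mn B mB.
refine (@measure_unique _ R (borel (pdual R V)) (@finitely_determined R V)
  (fun=> setT) _ _ _ _ mu nu _ _ B mB).
- exact: borel_finitely_determined.
- move=> C D fC fD; rewrite -[C `&` D]setCK setCI; apply: finitely_determinedC.
  by apply: finitely_determinedU; exact: finitely_determinedC.
- by move=> _; exists [::].
- by rewrite bigcup_const//; exists 0%N.
- move=> C fC; have [n lC] := (finitely_determinedP C).1 fC.
  have mC : measurable (C : set (borel (pdual R V))).
    exact: borel_open (finitely_determined_open fC).
  have : (fine (mu C))%:C = (fine (nu C))%:C.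
    by rewrite !(probability_cylinder _ lC) mn.
  by move=> /complexI e; rewrite -[LHS]fineK ?fin_num_measure// e fineK ?fin_num_measure.
- by move=> _; rewrite -ge0_fin_numE// fin_num_measure.
Qed.

End Restrictions.

(** * Averages over a finite orbit as averages over the acting group *)

Section FiniteOrbits.

Lemma card_fsum (K : idomainType) (I : choiceType) (D : set I) : finite_set D ->
  \sum_(i \in D) (1 : K) = #|` fset_set D|%:R.
Proof.
move=> fD; rewrite fsbig_finite// big_const_seq count_predT iter_addr_0.
by rewrite -[in RHS](mulr_natl 1) mulr1.
Qed.

(* All fibres of [i |-> act i x] over the orbit have the same cardinality. *)
Lemma orbit_average (K : numFieldType) (I X : choiceType) (act : I -> X -> X)
    (mul : I -> I -> I) (inv : I -> I) (x : X) (f : X -> K) :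
    finite_set [set: I] -> I ->
    (forall i j y, act i (act j y) = act (mul i j) y) ->
    (forall i y, act (inv i) (act i y) = y) ->
    (forall i, bijective (mul i)) ->
  (#|` fset_set (act^~ x @` [set: I])|%:R)^-1 *
    \sum_(y \in act^~ x @` [set: I]) f y =
  (#|` fset_set [set: I]|%:R)^-1 * \sum_(i \in [set: I]) f (act i x).
Proof.
move=> fI i0 actM actV bmul; set O := _ @` _.
have fO : finite_set O by exact: finite_image.
(* [N] counts the indices that fix [x]: the order of the stabiliser when [I] is a group. *)
pose N := \sum_(i \in [set: I]) ((x == act i x)%:R : K).
have sumE (h : X -> K) :
    \sum_(i \in [set: I]) h (act i x) = N * \sum_(y \in O) h y.
  transitivity (\sum_(i \in [set: I]) \sum_(y \in O) h y * (y == act i x)%:R).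
    apply: eq_fsbigr => i _; rewrite (fsum_delta h fO)//; first by exists i.
  rewrite exchange_fsbig// mulr_fsumr; apply: eq_fsbigr => _ /set_mem[j _ <-].
  rewrite -mulr_fsumr mulrC; congr (_ * _).
  (* Translation by [j] carries the indices fixing [x] onto those sending [x] to [act j x]. *)
  rewrite (reindex_fsbigT _ _ (bmul j)); apply: eq_fsbigr => i _.
  rewrite -actM; congr (_%:R); apply: f_equal.
  apply/eqP/eqP => [e|<-//].
  by rewrite -[LHS](actV j) e actV.
have cO : #|` fset_set [set: I]|%:R = N * #|` fset_set O|%:R :> K.
  by rewrite -!card_fsum// (sumE (fun=> 1)).
have nz : #|` fset_set [set: I]|%:R != 0 :> K.
  rewrite pnatr_eq0 cardfs_eq0; apply/eqP => I0.
  by move: (mem_set (Logic.I : [set: I] i0)); rewrite -in_fset_set// I0.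
rewrite sumE cO invfM mulrACA mulVf ?mul1r//.
by apply: contraNneq nz => N0; rewrite cO N0 mul0r.
Qed.

End FiniteOrbits.

(** * The two-sided action on the algebra and on its dual *)

Section BimoduleAction.
Variable A : nilRng.
Local Notation G := (alg_group A).
Implicit Types (g h : G) (a b : A).

Lemma sub1M g h : sub1 (g * h)%g = sub1 g + sub1 h + sub1 g ** sub1 h.
Proof. by []. Qed.

Lemma bimul1 a : bimul (1%g : G, 1%g : G) a = a.
Proof. by rewrite /bimul /= nmul0r nmulr0 !addr0. Qed.

Lemma bimul_comp (gam del : G * G) a :
  bimul gam (bimul del a) = bimul ((gam.1 * del.1)%g, (del.2 * gam.2)%g) a.
Proof.
(* The left and right multiplications are separated; they commute by associativity. *)
pose L g b := b + sub1 g ** b; pose M b g := b + b ** sub1 g.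
have bimulE g h b : bimul (g, h) b = M (L g b) h by [].
have LL g h b : L g (L h b) = L (g * h)%g b.
  by rewrite /L sub1M !nmulDl nmulDr nmulA -!addrA; congr (_ + _); rewrite addrCA.
have MM g h b : M (M b g) h = M b (g * h)%g.
  by rewrite /M sub1M !nmulDr nmulDl nmulA -!addrA.
have LM g h b : L g (M b h) = M (L g b) h.
  by rewrite /L /M nmulDl nmulDr nmulA -!addrA; congr (_ + _); rewrite addrCA.
by case: gam del => [g h] [g' h']; rewrite !bimulE LM MM LL.
Qed.

(* Hence a superclass function that is positive definite on the group is
   positive definite on the additive group of the algebra. *)
Lemma sub1_div g h : sub1 (h^-1 * g)%g = bimul ((h^-1)%g, 1%g) (sub1 g - sub1 h).
Proof.
rewrite sub1M /bimul/= nmulr0 addr0 nmulDr nmulrN.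
have := quasi_invl (sub1 h); set q := quasi_inv _ => /eqP.
rewrite -addrA addr_eq0 => /eqP qE.
by rewrite addrACA -opprD {1}qE [- _ + _]addrC addrAC.
Qed.

Variable R : realType.

(** The same transformations as [dual_act], parametrised without the inverse. The product compatible
    with composition is then [act_op], reversed in the first component. *)
Definition act (gam : G * G) : pdual R A -> pdual R A := pdual_comp (bimul gam).

Lemma actE gam theta a : pdual_eval (act gam theta) a = pdual_eval theta (bimul gam a).
Proof. by []. Qed.

Lemma dual_actE gam : dual_act gam = act (gam.1^-1, gam.2)%g.
Proof. by []. Qed.

Definition act_op (gam del : G * G) : G * G := (del.1 * gam.1, gam.2 * del.2)%g.

Lemma act_mul gam del theta : act gam (act del theta) = act (act_op gam del) theta.
Proof. by apply: pdual_ext => a; rewrite !actE bimul_comp. Qed.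

Lemma actK gam : cancel (act gam) (act (gam.1^-1, gam.2^-1)%g).
Proof.
move=> theta; apply: pdual_ext => a; rewrite !actE.
by rewrite bimul_comp /= mulgV mulVg bimul1.
Qed.

(** Images become preimages, to which measurability of [act] applies. *)
Lemma dual_act_image gam (B : set (pdual R A)) :
  dual_act gam @` B = act (gam.1, gam.2^-1)%g @^-1` B.
Proof.
rewrite dual_actE; apply/seteqP; split=> theta /=.
  move=> [chi Bc <-]; have := actK (gam.1^-1, gam.2)%g chi.
  by rewrite /= invgK => ->.
move=> Bt; exists (act (gam.1, gam.2^-1)%g theta) => //.
have := actK (gam.1, gam.2^-1)%g theta.
by rewrite /= invgK.
Qed.

Lemma act_measurable gam :
  measurable_fun setT (act gam : borel (pdual R A) -> borel (pdual R A)).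
Proof. exact: continuous_borel_borel (@pdual_comp_continuous R A A _). Qed.

Lemma act_preimage gam (B : set (pdual R A)) :
  act gam @^-1` B = dual_act (gam.1, gam.2^-1)%g @` B.
Proof. by rewrite dual_act_image /= invgK; case: gam. Qed.

Lemma invariant_act (mu : probability (borel (pdual R A)) R) : invariant_measure mu ->
  forall gam (B : set (borel (pdual R A))), measurable B -> mu (act gam @^-1` B) = mu B.
Proof. by move=> [_ inv] gam B mB; rewrite act_preimage inv. Qed.

Lemma act_invariant_fourier (mu : probability (borel (pdual R A)) R) :
    (forall gam (B : set (borel (pdual R A))), measurable B ->
      mu (act gam @^-1` B) = mu B) ->
  forall gam a, fourier mu (bimul gam a) = fourier mu a.
Proof.
move=> inv gam a.
exact: (cmean_comp (act_measurable gam) (inv gam) (cbounded_pdual_eval R a)).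
Qed.

(** By invariance and [sub1_div], the double sum of positive definiteness is the mean of the squared
    modulus of the sum of [c i * theta (g i - 1)]. *)
Lemma act_invariant_supercharacter (mu : probability (borel (pdual R A)) R) :
    (forall gam (B : set (borel (pdual R A))), measurable B ->
      mu (act gam @^-1` B) = mu B) ->
  supercharacter (xi_measure mu).
Proof.
move=> inv; have xiE g : xi_measure mu g = fourier mu (sub1 g) by [].
split.
- move=> n g c.
  have -> : \sum_(i < n) \sum_(j < n) c i * (c j)^* * xi_measure mu ((g j)^-1 * g i)%g =
      \sum_(i < n) 1 * cmean mu (fun theta : borel (pdual R A) =>
        \sum_(j < n) c i * (c j)^* *
          pdual_eval (theta : pdual R A) (sub1 (g i) - sub1 (g j))).
    apply: eq_bigr => i _; rewrite mul1r cmean_sum; last first.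
      by move=> j; exact: cbounded_pdual_eval.
    apply: eq_bigr => j _; congr (_ * _).
    by rewrite xiE sub1_div act_invariant_fourier.
  rewrite -cmean_sum; last first.
    move=> i; apply: cbounded_mfun_sum => j; exact: cbounded_pdual_eval.
  apply: cmean_ge0 => theta.
  have -> : \sum_(i < n) 1 * (\sum_(j < n) c i * (c j)^* *
      pdual_eval (theta : pdual R A) (sub1 (g i) - sub1 (g j))) =
    (\sum_(i < n) c i * pdual_eval theta (sub1 (g i))) *
    (\sum_(i < n) c i * pdual_eval theta (sub1 (g i)))^*.
    rewrite mulr_suml; apply: eq_bigr => i _; rewrite mul1r rmorph_sum mulr_sumr.
    by apply: eq_bigr => j _; rewrite rmorphM/= pdual_evalB mulrACA.
  exact: mul_conjC_ge0.
- rewrite xiE /fourier -[RHS](cmean_cst mu 1); congr cmean.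
  by apply/funext => theta; exact: pdual_eval0.
- by move=> a _ _ [gam _ <-] [del _ <-]; rewrite !xiE !act_invariant_fourier.
Qed.

Lemma supercharacter_fun_pd (xi : G -> R[i]) : supercharacter xi ->
  forall n (a : 'I_n -> A) (c : 'I_n -> R[i]),
  0 <= \sum_(i < n) \sum_(j < n) c i * (c j)^* * xi (OnePlus (a i - a j)).
Proof.
move=> [pd _ sc] n a c; have := pd n (fun i => OnePlus (a i)) c.
congr (_ <= _); apply: eq_bigr => i _; apply: eq_bigr => j _; congr (_ * _).
apply: (sc (a i - a j)).
  exists ((OnePlus (a j))^-1%g, 1%g) => //.
  by apply: val_inj; exact: esym (sub1_div (OnePlus (a i)) (OnePlus (a j))).
by exists (1%g, 1%g) => //; rewrite bimul1.
Qed.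

Lemma supercharacter_bimul (xi : G -> R[i]) gam a : supercharacter xi ->
  xi (OnePlus (bimul gam a)) = xi (OnePlus a).
Proof.
move=> [_ _ sc]; apply: (sc a); first by exists gam.
by exists (1%g, 1%g) => //; rewrite bimul1.
Qed.

End BimoduleAction.

(** * Conditional and image probabilities *)

Section ProbabilityConstructions.
Context d (T : measurableType d) (R : realType) (P : probability T R).

Lemma conditional_probability (B : set T) : measurable B -> P B != 0%E ->
  exists Q : probability T R, forall C, measurable C ->
    Q C = (P (C `&` B) * ((fine (P B))^-1)%:E)%E.
Proof.
move=> mB PB0; pose m : measure T R := mrestr P mB.
have mT : m setT = P B by rewrite /m /= /mrestr setTI.
have PBy : (P B == +oo%E) = false.
  by apply/negbTE; rewrite -ltey -ge0_fin_numE// fin_num_measure.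
(* The second argument is the default taken by the normalisation when the total mass is zero or
   infinite; both cases are excluded here. *)
exists (mnormalize m P) => C mC.
suff : mnormalize m P C = (P (C `&` B) * ((fine (P B))^-1)%:E)%E by [].
by rewrite /mnormalize mT (negbTE PB0) PBy.
Qed.

Lemma image_probability (f : T -> T) : measurable_fun setT f ->
  exists Q : probability T R, forall C, Q C = P (f @^-1` C).
Proof.
move=> mf; exists (distribution P (mfun_Sub (mem_set mf))) => C.
by rewrite /= /distribution /pushforward.
Qed.

End ProbabilityConstructions.

(** * The chain of finite additive subgroups of the algebra *)

Section AFAlgebras.
Variables (k : fieldType) (A : nilAlgType k) (F : AF_structure A).

Definition af_set n : set A := [set a | a \in subalg_pred (af_alg F n)].

Lemma af_set_finite n : finite_set (af_set n).
Proof.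
apply: (@sub_finite_set _ _ (@sub1 A @` one_plus (af_alg F n))).
  by move=> a Sa; exists (OnePlus a).
by apply: finite_image; exact: af_group_finite.
Qed.

Lemma af_set0 (n : nat) : af_set n 0.
Proof. by have [] := subalg_zmod (af_alg F n). Qed.

Lemma af_setB n a b : af_set n a -> af_set n b -> af_set n (a - b).
Proof. by have [_] := subalg_zmod (af_alg F n); exact. Qed.

Lemma af_set_chain m n : (m <= n)%N -> af_set m `<=` af_set n.
Proof.
elim: n => [|n IHn]; first by rewrite leqn0 => /eqP->.
rewrite leq_eqVlt => /predU1P[->//|/IHn mn] a /mn Sa.
exact: (@af_group_chain _ _ F n (OnePlus a) Sa).
Qed.

Lemma af_set_cover a : exists n, af_set n a.
Proof.
have [n _ ag] : (\bigcup_m one_plus (af_alg F m)) (OnePlus a).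
  by rewrite af_group_cover.
by exists n.
Qed.

(* A nonzero element of [A] has finite additive order, so the scalar field has
   positive characteristic. *)
Lemma af_prime_exponent : exists2 p, prime p & forall a : A, a *+ p = 0.
Proof.
have [[a a0]|A0] := pselect (exists a : A, a != 0); last first.
  exists 2 => // a; apply/eqP; rewrite -[_ == _]negbK; apply/negP => a2.
  apply: A0; exists a; apply: contraNneq a2 => ->; by rewrite mul0rn.
have [n na] := af_set_cover a.
have fW := af_set_finite n.
set m := #|` fset_set (af_set n)|.
(* Translation by [a] permutes [af_set n], so adding [m] copies of [a] does not change the sum of
   its elements. *)
have ma : a *+ m = 0.
  apply: (addrI (\sum_(b \in af_set n) b)); rewrite addr0.
  rewrite [RHS](reindex_fsbig _ _ _ _ (subgroup_shift af_set0 af_setB na)).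
  rewrite fsbig_split//=; congr (_ + _).
  by rewrite fsbig_finite// big_const_seq count_predT iter_addr_0.
have m0 : (0 < m)%N.
  rewrite lt0n cardfs_eq0; apply/eqP => Wn0.
  by move: (mem_set (af_set0 n)); rewrite -in_fset_set// Wn0.
have [|p pk] := @natf0_pchar k m m0.
  move/eqP: ma; rewrite -[a]scale1r scalerMnl scaler_eq0 (negbTE a0) orbF.
  by [].
have [p_prime /eqP p0] := andP pk; exists p => // b.
by rewrite -[b]scale1r scalerMnl p0 scale0r.
Qed.

End AFAlgebras.

(** * The supercharacters of the finite groups as averages on the full dual *)

Section RestrictedOrbits.
Variables (R : realType) (k : fieldType) (A : nilAlgType k) (F : AF_structure A).
Local Notation G := (alg_group A).

(** [Gam_n] is kept as a subset of [G * G], so that all levels act on the one dual of [A]. *)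
Definition af_pairs n : set (G * G) :=
  [set gam | af_set F n (sub1 gam.1) /\ af_set F n (sub1 gam.2)].

Lemma af_pairs_finite n : finite_set (af_pairs n).
Proof.
apply: (@sub_finite_set _ _ (one_plus (af_alg F n) `*` one_plus (af_alg F n))).
  by move=> [g h] [].
by apply: finite_setX; exact: af_group_finite.
Qed.

Lemma af_pairs1 n : af_pairs n (1%g, 1%g).
Proof. by split; exact: af_set0. Qed.

Lemma af_pairs_chain m n : (m <= n)%N -> af_pairs m `<=` af_pairs n.
Proof. by move=> mn gam [g h]; split; exact: af_set_chain mn _ _. Qed.

Lemma af_mulV n g h : af_set F n (sub1 g) -> af_set F n (sub1 h) ->
  af_set F n (sub1 (g * h^-1)%g).
Proof.
have [_ gc] := one_plus_group_closed (af_alg F n).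
move=> Wg Wh; have := gc g h; rewrite !inE; exact.
Qed.

Lemma af_inv n g : af_set F n (sub1 g) -> af_set F n (sub1 g^-1%g).
Proof. by move=> Wg; rewrite -[(g^-1)%g]mul1g; apply: af_mulV => //; exact: af_set0. Qed.

Lemma af_mul n g h : af_set F n (sub1 g) -> af_set F n (sub1 h) ->
  af_set F n (sub1 (g * h)%g).
Proof. by move=> Wg Wh; rewrite -[h]invgK; apply: af_mulV => //; exact: af_inv. Qed.

Lemma af_pairs_op n del : af_pairs n del ->
  set_bij (af_pairs n) (af_pairs n) (@act_op A ^~ del).
Proof.
move=> [W1 W2]; split.
- by move=> gam [V1 V2]; split; exact: af_mul.
- move=> [g h] [g' h'] _ _ e; congr (_, _).
    exact: mulgI (congr1 fst e).
  exact: mulIg (congr1 snd e).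
move=> gam [V1 V2]; exists ((del.1^-1 * gam.1)%g, (gam.2 * del.2^-1)%g).
  by split; apply: af_mul => //; exact: af_inv.
by rewrite /act_op /= mulVKg mulgVK; case: gam {V1 V2}.
Qed.

Section Level.
Variable n : nat.
Local Notation S := (subalg_sort (af_alg F n)).
Local Notation H := (alg_group S).

Definition incl (h : H) : G := OnePlus (val (sub1 h)).

Lemma incl_inj : injective incl.
Proof. by move=> [x] [y] [/val_inj ->]. Qed.

Lemma alg_group_finite : finite_set [set: H * H].
Proof.
rewrite -setXTT; have fH : finite_set [set: H].
  apply: (@sub_finite_set _ _ ((fun g : G => OnePlus (insubd (0 : S) (sub1 g)))
    @` one_plus (af_alg F n))).
    move=> h _; exists (incl h); first exact: (valP (sub1 h)).
    by apply: val_inj; exact: valKd.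
  by apply: finite_image; exact: af_group_finite.
exact: finite_setX.
Qed.

(** The inverse on the first component compensates for the one in [dual_act]. *)
Lemma incl_pairs_bij :
  set_bij [set: H * H] (af_pairs n) (fun gam => (incl gam.1^-1%g, incl gam.2)).
Proof.
split.
- move=> gam _; split; first exact: (valP (sub1 (gam.1^-1)%g)).
  exact: (valP (sub1 gam.2)).
- move=> [g h] [g' h'] _ _ e; congr (_, _).
    exact/invg_inj/incl_inj/(congr1 fst e).
  exact/incl_inj/(congr1 snd e).
move=> [g h] [/= Wg Wh].
exists ((OnePlus (Sub (sub1 g) Wg : S))^-1%g, OnePlus (Sub (sub1 h) Wh : S)) => //.
by rewrite /= invgK; congr (_, _); apply: val_inj; exact: SubK.
Qed.

Lemma restr_supercharacter_average (theta : pdual R A) g : af_set F n (sub1 g) ->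
  restr_supercharacter (af_alg F n) theta g =
  (#|` fset_set (af_pairs n)|%:R)^-1 *
    \sum_(gam \in af_pairs n) pdual_eval (act gam theta) (sub1 g).
Proof.
move=> Wg; rewrite /restr_supercharacter insubT/=.
set b : S := Sub (sub1 g) Wg.
set theta' := pdual_comp _ theta.
have fH := alg_group_finite; have fP := @af_pairs_finite n.
rewrite /orbit_supercharacter /dual_orbit.
rewrite (@orbit_average R[i] (H * H)%type _ (@dual_act R S)
  (fun i j => (i.1 * j.1, i.2 * j.2)%g) (fun i => (i.1^-1, i.2^-1)%g) theta'
  (fun chi => pdual_eval chi b) fH (1%g, 1%g)).
(* After reindexing, the summands agree by computation: acting on the restriction of [theta] amounts
   to restricting the transformed character. *)
- rewrite -!card_fsum// !(reindex_fsbig _ _ _ _ incl_pairs_bij); congr (_ * _).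
- move=> i j y; rewrite !dual_actE act_mul; congr act.
  by rewrite /act_op /= invgM.
- by move=> i y; rewrite !dual_actE; exact: (actK (i.1^-1, i.2)%g).
- move=> i; exists (fun j => (i.1^-1 * j.1, i.2^-1 * j.2)%g) => -[j j'] /=.
    by rewrite !mulKg.
  by rewrite !mulVKg.
Qed.

End Level.
End RestrictedOrbits.

(** * Convergence for ergodic measures, and ergodicity from indecomposability *)

Section MainArgument.
Variables (R : realType) (k : fieldType) (A : nilAlgType k) (F : AF_structure A).
Local Notation G := (alg_group A).
Local Notation W := (af_set F).
Local Notation D := (af_pairs F).
Local Notation avg := (@average _ (borel (pdual R A)) R (G * G)%type (@act A R) D).
Implicit Types mu : probability (borel (pdual R A)) R.

Lemma af_fourier_inj mu nu : fourier mu =1 fourier nu ->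
  forall B, measurable B -> mu B = nu B.
Proof.
have [p pp pk] := af_prime_exponent F.
exact: (fourier_inj pp pk (@af_set_finite _ _ F) (@af_set0 _ _ F) (@af_setB _ _ F)
  (@af_set_chain _ _ F) (@af_set_cover _ _ F)).
Qed.

Lemma average_complex n (f : pdual R A -> R[i]) theta :
  (#|` fset_set (D n)|%:R)^-1 * \sum_(gam \in D n) f (act gam theta) =
  (avg n (fun x => complex.Re (f x)) theta) +i*
  (avg n (fun x => complex.Im (f x)) theta).
Proof.
have fD := @af_pairs_finite _ _ F n.
rewrite /average !fsbig_finite//.
have -> : (#|` fset_set (D n)|%:R)^-1 = ((#|` fset_set (D n)|%:R : R)^-1)%:C :> R[i].
  by rewrite fmorphV rmorph_nat.
rewrite [X in _ * X](_ : _ =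
  (\sum_(gam <- fset_set (D n)) complex.Re (f (act gam theta))) +i*
  (\sum_(gam <- fset_set (D n)) complex.Im (f (act gam theta)))).
  by apply/eqP; rewrite eq_complex/= !mul0r subr0 addr0 !eqxx.
elim: (enum_fset _) => [|gam s IHs]; first by rewrite !big_nil.
by rewrite !big_cons IHs [f _ in LHS]complexE; case: (f _) => x y /=; simpc.
Qed.

Lemma ergodic_convergence mu : invariant_measure mu -> ergodic_measure mu ->
  \forall theta \ae mu, forall g : G,
    (fun m => restr_supercharacter (af_alg F m) theta g : R[i]^o)
      @ \oo --> (xi_measure mu g : R[i]^o).
Proof.
move=> inv erg.
have cvg_avg (f : borel (pdual R A) -> R) : bounded_mfun f ->
    {ae mu, forall x, avg n f x @[n --> \oo] --> \int[mu]_x f x}.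
  apply: (@average_cvg _ (borel (pdual R A)) R mu (G * G)%type (@act A R) (@act_op A) D).
  - exact: af_pairs_finite.
  - by move=> n; exists (1%g, 1%g); exact: af_pairs1.
  - exact: af_pairs_chain.
  - exact: act_mul.
  - exact: af_pairs_op.
  - exact: act_measurable.
  - exact: invariant_act.
  (* Each pair of [G * G] lies in some [D n], so invariance under all the [D n] is invariance under
     the whole group. *)
  - move=> B mB Binv; apply: erg => // gam; rewrite dual_act_image.
    have [m Wm] := af_set_cover F (sub1 gam.1).
    have [n Wn] := af_set_cover F (sub1 gam.2).
    apply: (Binv (maxn m n)); split; first exact: af_set_chain (leq_maxl m n) _ Wm.
    apply: af_inv; exact: af_set_chain (leq_maxr m n) _ Wn.
have cvg_at (a : A) : {ae mu, forall theta : pdual R A,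
    (fun m => restr_supercharacter (af_alg F m) theta (OnePlus a) : R[i]^o)
      @ \oo --> (xi_measure mu (OnePlus a) : R[i]^o)}.
  have [bR bI] := cbounded_pdual_eval R a.
  have := cvg_avg _ bI; have := cvg_avg _ bR; apply: filterS2 => theta cR cI.
  have [m Wa] := af_set_cover F a.
  have E n : (m <= n)%N -> restr_supercharacter (af_alg F n) theta (OnePlus a) =
    (avg n (fun x => complex.Re (pdual_eval x a)) theta) +i*
    (avg n (fun x => complex.Im (pdual_eval x a)) theta).
    move=> mn; rewrite restr_supercharacter_average; last exact: af_set_chain mn _ Wa.
    exact: (average_complex n (fun x => pdual_eval x a)).
  apply: complex_cvg.
    apply: cvg_trans cR; apply: near_eq_cvg; exists m => // n /= mn.
    by rewrite E.
  apply: cvg_trans cI; apply: near_eq_cvg; exists m => // n /= mn.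
  by rewrite E.
(* The elements of [A] are listed as entries of the finite sets [W n], so countably many null sets
   are discarded. An index beyond the end of the list gives the default 0, where the convergence
   holds as well. *)
have : {ae mu, forall theta : pdual R A, forall n i,
    (fun m => restr_supercharacter (af_alg F m) theta (OnePlus (fset_set (W n))`_i) : R[i]^o)
      @ \oo --> (xi_measure mu (OnePlus (fset_set (W n))`_i) : R[i]^o)}.
  by apply: ae_foralln => n; apply: ae_foralln => i; exact: cvg_at.
have aeF : Filter (almost_everywhere mu) by exact: ae_filter_ringOfSetsType.
apply: filterS => theta ct [a].
have [n Wa] := af_set_cover F a.
have ain : a \in fset_set (W n) by rewrite in_fset_set ?mem_set//; exact: af_set_finite.
by rewrite -(nth_index 0 ain); exact: ct.
Qed.

Lemma indecomposable_ergodic mu :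
    (forall gam (B : set (borel (pdual R A))), measurable B ->
      mu (act gam @^-1` B) = mu B) ->
  indecomposable_supercharacter (xi_measure mu) -> ergodic_measure mu.
Proof.
move=> inv [_ indec] B mB Binv.
have Bact gam : act gam @^-1` B = B by rewrite act_preimage Binv.
have [B0|B0] := eqVneq (mu B) 0%E; first by left.
right; apply/eqP; apply/negPn/negP => B1.
have mC : measurable (~` B) by exact: measurableC.
have PC : mu (~` B) = (1 - mu B)%E by exact: probability_setC.
have PE C : measurable C -> mu C = (fine (mu C))%:E.
  by move=> mC'; rewrite fineK// fin_num_measure.
pose t := fine (mu B).
have t0 : 0 < t.
  rewrite lt0r fine_ge0 ?measure_ge0// andbT; apply: contra B0 => /eqP t0.
  by rewrite (PE _ mB) -/t t0.
have tC : fine (mu (~` B)) = 1 - t by rewrite PC (PE _ mB).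
have t1 : t < 1.
  rewrite lt_neqAle; apply/andP; split.
    by apply: contra B1 => /eqP t1; rewrite (PE _ mB) -/t t1.
  by rewrite -subr_ge0 -tC fine_ge0 ?measure_ge0.
have C0 : mu (~` B) != 0%E.
  rewrite (PE _ mC) tC; apply/eqP => -[/eqP]; rewrite subr_eq0 => /eqP e.
  by move: t1; rewrite -e ltxx.
have [Q1 Q1E] := conditional_probability mB B0.
have [Q2 Q2E] := conditional_probability mC C0.
have [p pp pk] := af_prime_exponent F.
have mix C : measurable C -> fine (mu C) = t * fine (Q1 C) + (1 - t) * fine (Q2 C).
  move=> mC'; rewrite Q1E// Q2E//.
  have mCB : measurable (C `&` B) by exact: measurableI.
  have mCC : measurable (C `&` ~` B) by exact: measurableI.
  rewrite (PE _ mCB) (PE _ mCC)/= tC -/t.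
  rewrite mulrCA mulfV ?gt_eqF// mulr1 mulrCA mulfV ?mulr1 ?gt_eqF ?subr_gt0//.
  by rewrite (measureDI mu mC' mB) setDE addeC fineD ?fin_num_measure.
have invQ1 gam (C : set (borel (pdual R A))) : measurable C -> Q1 (act gam @^-1` C) = Q1 C.
  move=> mC'; rewrite !Q1E//; last first.
    by rewrite -[X in measurable X]setTI; exact: act_measurable.
  by rewrite -{1}(Bact gam) -preimage_setI inv//; exact: measurableI.
have invQ2 gam (C : set (borel (pdual R A))) : measurable C -> Q2 (act gam @^-1` C) = Q2 C.
  move=> mC'; rewrite !Q2E//; last first.
    by rewrite -[X in measurable X]setTI; exact: act_measurable.
  by rewrite -{1}(Bact gam) preimage_setC -preimage_setI inv//; exact: measurableI.
have [||Q1xi _] := indec _ _ t (act_invariant_supercharacter invQ1)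
  (act_invariant_supercharacter invQ2); first by rewrite t0.
  (* The identity [mix] concerns masses of sets; it passes to transforms because each of these is a
     finite sum over masses of classes. *)
  move=> g; have [n Wg] := af_set_cover F (sub1 g).
  have fE nu : xi_measure nu g = \sum_(r \in @restrictions R A W n)
      r (sub1 g) * (fine (nu (restr_class W n r)))%:C.
    exact: (fourier_cylinder pp pk (@af_set_finite _ _ F) (@af_set0 _ _ F)
      (@af_setB _ _ F) nu Wg).
  have finR : finite_set (@restrictions R A W n).
    exact: (restrictions_finite R pp pk (@af_set_finite _ _ F) (@af_set0 _ _ F) (@af_setB _ _ F)).
  rewrite !fE !mulr_fsumr -fsbig_split//=; apply: eq_fsbigr => r _.
  rewrite mix; last first.
    exact: (restr_class_measurable (@af_set_finite _ _ F) (@af_set0 _ _ F) (@af_setB _ _ F)).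
  by rewrite rmorphD !rmorphM/= mulrDr [X in X + _]mulrCA [X in _ + X]mulrCA.
(* Indecomposability gives [Q1] the transform of [mu], so the two probabilities agree; but
   conditioning on [B] gives [B] mass 1, against [B1]. *)
have Q1mu : Q1 B = mu B.
  by apply: af_fourier_inj => // a; exact: (congr1 (@^~ (OnePlus a)) Q1xi).
move: B1; rewrite -Q1mu Q1E// setIid (PE _ mB) -/t -EFinM mulfV ?eqxx//.
by rewrite gt_eqF.
Qed.

End MainArgument.

Theorem theorem4p1 (R : realType) (k : fieldType) (A : nilAlgType k)
    (F : AF_structure A) :
  (forall mu : probability (borel (pdual R A)) R,
     invariant_measure mu -> ergodic_measure mu ->
     \forall theta \ae mu, forall g : alg_group A,
       (fun m => restr_supercharacter (af_alg F m) theta g : R[i]^o)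
         @ \oo --> (xi_measure mu g : R[i]^o)) /\
  (forall xi : alg_group A -> R[i],
     indecomposable_supercharacter xi ->
     exists mu : probability (borel (pdual R A)) R,
       [/\ invariant_measure mu, ergodic_measure mu, xi = xi_measure mu &
         \forall theta \ae mu, forall g : alg_group A,
           (fun m => restr_supercharacter (af_alg F m) theta g : R[i]^o)
             @ \oo --> (xi g : R[i]^o)]).
Proof.
split=> [mu|xi xi_indec]; first exact: ergodic_convergence.
have [xi_sc _] := xi_indec.
have [p pp pk] := af_prime_exponent F.
have xi1 : xi (OnePlus 0) = 1 by have [_ + _] := xi_sc.
have [mu [mu_reg mu_xi]] := bochner pp pk (@af_set_finite _ _ F) (@af_set0 _ _ F)
  (@af_setB _ _ F) (@af_set_chain _ _ F) (@af_set_cover _ _ F)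
  (psi := fun a => xi (OnePlus a)) (supercharacter_fun_pd xi_sc) xi1.
have xiE : xi = xi_measure mu.
  by apply/funext => -[a]; rewrite -[LHS]mu_xi.
(* The image of [mu] under [act gam] has the transform of [mu] composed with [bimul gam], which is
   again that of [mu] since [xi] is constant on superclasses. *)
have act_inv gam (B : set (borel (pdual R A))) : measurable B ->
    mu (act gam @^-1` B) = mu B.
  move=> mB; have [nu nuE] := image_probability mu (act_measurable gam).
  rewrite -nuE; apply: (af_fourier_inj F) => // a.
  transitivity (fourier mu (bimul gam a)).
    apply/esym/(cmean_comp (act_measurable gam)); last exact: cbounded_pdual_eval.
    by move=> C mC; rewrite nuE.
  by rewrite !mu_xi supercharacter_bimul.
have inv : invariant_measure mu.
  split=> // gam B mB.
  by rewrite dual_act_image act_inv.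
have erg : ergodic_measure mu.
  by apply: (indecomposable_ergodic F) => //; rewrite -xiE.
exists mu; split=> //.
by rewrite xiE; exact: ergodic_convergence.
Qed.
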